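(* Let $Q$ be a positive-definite rank-$g$ form. Then $Q$ is a tropical Riemann matrix of a metric graph if and only if all conorms $\lambda_e$ ($0\neq e\in V^*$) are nonnegative and the positive conorm support matroid $M(E)$, $E=\{e:\lambda_e>0\}$, is cographic. When these conditions hold, the positive conorms are the edge lengths of the recovered simple cographic representation, after bridges are deleted and coedges with the same mod-2 class are aggregated, and $$Q=A\,\mathrm{diag}(\lambda_e)\,A^{\mathsf T}$$ is an exact graph-period certificate, where $A=(a_e)_{e\in E}$ is the matrix of reconstructed coedges.
   Context: $L$ is a lattice (free abelian group) of rank $g$, $L_{\mathbb R}=L\otimes_{\mathbb Z}\mathbb R$, $L^*=\mathrm{Hom}(L,\mathbb Z)$, and $Q$ is a positive-definite quadratic form on $L_{\mathbb R}$, identified with its matrix in an integral basis of $L$. Put $V=L/2L$, $V^*=\mathrm{Hom}_{\mathbb F_2}(V,\mathbb F_2)$, and let $[x]$ be the class of $x\in L$ in $V$. Vonorms: $\mu(\alpha)=\min\{Q[x]:x\in L,\ [x]=\alpha\}$ for $\alpha\in V$. Conorms: $\lambda_e=-2^{1-g}\sum_{\alpha\in V}(-1)^{e(\alpha)}\mu(\alpha)$ for $0\neq e\in V^*$. When all conorms are nonnegative, $M(E)$ is the binary matroid on $E=\{e:\lambda_e>0\}$ whose independent sets are the subsets linearly independent over $\mathbb F_2$ in $V^*$; it is simple, since its elements are distinct nonzero vectors. A matroid is cographic if it is isomorphic to the dual $M^*(G)$ of the graphic matroid of some graph $G$. Graphs: let $\Gamma$ be a finite connected graph with edge lengths $\ell_f>0$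 (a metric graph) and a chosen orientation of every edge. Its genus is $|E(\Gamma)|-|V(\Gamma)|+1$, and $H_1(\Gamma,\mathbb Z)=\ker(\partial:\mathbb Z^{E(\Gamma)}\to\mathbb Z^{V(\Gamma)})$, where $\partial$ sends an oriented edge to its head minus its tail. The coedge $c_f$ of an edge $f$ is the restriction of the $f$-th coordinate to $H_1(\Gamma,\mathbb Z)$ (zero if $f$ is a bridge). The period form of $\Gamma$ is $\sum_f\ell_f c_f^2$. $Q$ is a tropical Riemann matrix of $\Gamma$ if $\Gamma$ has genus $g$ and there is an isomorphism $L\cong H_1(\Gamma,\mathbb Z)$ under which $Q$ becomes the period form of $\Gamma$. Aggregating coedges with the same mod-2 class means replacing them by a single coedge carrying their total length. Reconstructed coedges (when all conorms are nonnegative): for $\alpha\in V$ let $D(\alpha)=\{e\in E:e(\alpha)=1\}$. A cocircuit is an inclusion-minimal set among the $D(\alpha)$ with $\alpha\neq0$. For a cocircuit $D$, let $r_D\in L$ be a shortest vector for $Q$ in the unique parity class $\alpha_D$ with $D(\alpha_D)=D$; it is unique up to sign. For $e\in E$, let $L_e$ be the subgroup of $L$ generated by all $r_D$ with $e\notin D$, which is a primitive sublattice of rank $g-1$. The reconstructed coedge $a_e\in L^*$ is a primitive covector with $\ker a_e=L_e$, unique up to sign. The columns of $A$ are the $a_e$ in an integral basis of $L$; they represent $M(E)$, and when $M(E)$ is cographic they give the recovered simple cographic representation. ''Exact graph-period certificate'' means that the displayed expression exhibits $Q$ as the period form of a graph with edge lengths $\lambda_e$, whose coedge matrix agrees with $A$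 up to an integral change of basis, column signs and column permutation. *)

(* Defs.v *)
(* Mathematical Components, with MathComp-Analysis for the real numbers. *)
From HB Require Import structures.
From mathcomp Require Import all_boot all_order all_algebra.
From mathcomp Require Import boolp classical_sets reals.

Set Implicit Arguments.
Unset Strict Implicit.
Unset Printing Implicit Defensive.

Import Order.TTheory GRing.Theory Num.Theory.
Local Open Scope ring_scope.

(* The lattice L is 'cV[int]_g (an integral basis is fixed), L^* is 'rV[int]_g,
   V = L / 2L is 'cV['F_2]_g and V^* is 'rV['F_2]_g; the pairing of a covector
   with a vector is their matrix product. *)

Definition scalar_of {S : Type} (M : 'M[S]_1) : S := M 0 0.

Section Forms.
Variables (R : realType) (g : nat).

Definition quad (Q : 'M[R]_g) (x : 'cV[R]_g) : R :=
  scalar_of (x^T *m Q *m x).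

Definition posdef_form (Q : 'M[R]_g) : Prop :=
  Q^T = Q /\ forall x : 'cV[R]_g, x != 0 -> 0 < quad Q x.

Definition quadZ (Q : 'M[R]_g) (x : 'cV[int]_g) : R := quad Q (map_mx intr x).

Definition parity (x : 'cV[int]_g) : 'cV['F_2]_g := map_mx intr x.

Definition coparity (c : 'rV[int]_g) : 'rV['F_2]_g := map_mx intr c.

Definition pairing (e : 'rV['F_2]_g) (alpha : 'cV['F_2]_g) : 'F_2 :=
  scalar_of (e *m alpha).

(* The least element of a set of reals, and 0 if there is none. *)
Definition minimum (S : set R) : R := xget 0 (S `&` lbound S)%classic.

Definition vonorm (Q : 'M[R]_g) (alpha : 'cV['F_2]_g) : R :=
  minimum [set quadZ Q x | x in [set x | parity x = alpha]]%classic.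

(* Only meaningful for e != 0. *)
Definition conorm (Q : 'M[R]_g) (e : 'rV['F_2]_g) : R :=
  - (2 ^ (1 - g%:Z) *
     \sum_(alpha : 'cV['F_2]_g) (-1) ^+ (pairing e alpha : nat) * vonorm Q alpha).

Definition conorms_ge0 (Q : 'M[R]_g) : Prop :=
  forall e : 'rV['F_2]_g, e != 0 -> 0 <= conorm Q e.

Definition csupp (Q : 'M[R]_g) : {set 'rV['F_2]_g} :=
  [set e : 'rV['F_2]_g | (e != 0) && (0 < conorm Q e)].

End Forms.

(* Matroids are presented by their ground set and their independent sets. *)
Record indsys := IndSys {
  ground : finType;
  indep : {set ground} -> Prop
}.

Definition indsys_iso (M M' : indsys) : Prop :=
  exists2 h : ground M -> ground M', bijective h &
    forall S : {set ground M}, indep S <-> indep (h @: S).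

Definition is_basis (M : indsys) (B : {set ground M}) : Prop :=
  indep B /\ forall B' : {set ground M}, indep B' -> B \subset B' -> B' = B.

(* The bases of the dual are the complements of the bases, so the independent
   sets of the dual are the sets which avoid some basis. *)
Definition dual_indsys (M : indsys) : indsys :=
  @IndSys (ground M)
    (fun S => exists2 B : {set ground M}, is_basis B & [disjoint S & B]).

Definition binary_matroid (g : nat) (E : {set 'rV['F_2]_g}) : indsys :=
  @IndSys {e : 'rV['F_2]_g | e \in E} (fun S => free [seq val e | e in S]).

(* Finite multigraphs with an orientation of every edge (from src to tgt);
   loops and parallel edges are allowed. *)
Record graph := Graph {
  vert : finType;
  edge : finType;
  src : edge -> vert;
  tgt : edge -> vert
}.

Section Graphs.
Variable G : graph.

Definition adj (S : {set edge G}) : rel (vert G) := fun u v =>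
  [exists f in S, ((src f == u) && (tgt f == v)) || ((src f == v) && (tgt f == u))].

Definition connected_graph : Prop :=
  (0 < #|vert G|)%N /\ forall u v : vert G, connect (adj [set: edge G]) u v.

Definition bridge (f : edge G) : bool :=
  ~~ connect (adj [set~ f]) (src f) (tgt f).

Definition genus : int := #|edge G|%:Z - #|vert G|%:Z + 1.

(* A dart (f, b) is the edge f traversed from src to tgt if b, and backwards
   otherwise. *)
Definition dart_tail (d : edge G * bool) : vert G :=
  if d.2 then src d.1 else tgt d.1.
Definition dart_head (d : edge G * bool) : vert G :=
  if d.2 then tgt d.1 else src d.1.

(* Simple closed walks; a loop and a pair of parallel edges are included. *)
Definition graph_cycle (s : seq (edge G * bool)) : Prop :=
  [/\ s != [::],
      cycle (fun d d' => dart_head d == dart_tail d') s,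
      uniq [seq dart_tail d | d <- s] &
      uniq [seq d.1 | d <- s]].

Definition acyclic (S : {set edge G}) : Prop :=
  forall s, graph_cycle s -> ~~ all (fun d => d.1 \in S) s.

Definition graphic_matroid : indsys := @IndSys (edge G) acyclic.

Definition boundary (x : {ffun edge G -> int}) : {ffun vert G -> int} :=
  [ffun v => \sum_(f | tgt f == v) x f - \sum_(f | src f == v) x f].

End Graphs.

Definition cographic (M : indsys) : Prop :=
  exists G : graph, indsys_iso M (dual_indsys (graphic_matroid G)).

Record metric_graph (R : realType) := MetricGraph {
  mgraph :> graph;
  len : edge mgraph -> R;
  len_gt0 : forall f, 0 < len f;
  mgraph_connected : connected_graph mgraph
}.

Definition iso_onto_H1 (G : graph) (g : nat)
    (phi : {additive 'cV[int]_g -> {ffun edge G -> int}}) : Prop :=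
  injective phi /\ forall z, boundary z = 0 <-> exists x, phi x = z.

(* The coedge c_f, transported to L^* along phi : L -> H_1(G, Z). *)
Definition coedge (G : graph) (g : nat)
    (phi : {additive 'cV[int]_g -> {ffun edge G -> int}}) (f : edge G) :
    'rV[int]_g :=
  \row_i phi (delta_mx i 0) f.

Section Realization.
Variables (R : realType) (g : nat) (Q : 'M[R]_g).

Definition period_form (Gamma : metric_graph R) (z : {ffun edge Gamma -> int}) : R :=
  \sum_(f : edge Gamma) len f * (z f)%:~R ^+ 2.

Definition realizes (Gamma : metric_graph R)
    (phi : {additive 'cV[int]_g -> {ffun edge Gamma -> int}}) : Prop :=
  [/\ genus Gamma = g%:Z, iso_onto_H1 phi &
      forall x : 'cV[int]_g, quadZ Q x = period_form (phi x)].

Definition tropical_Riemann_matrix (Gamma : metric_graph R) : Prop :=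
  exists phi : {additive 'cV[int]_g -> {ffun edge Gamma -> int}}, realizes phi.

End Realization.

Section Reconstruction.
Variables (R : realType) (g : nat) (Q : 'M[R]_g).
Implicit Types (D : {set 'rV['F_2]_g}) (r : {set 'rV['F_2]_g} -> 'cV[int]_g)
  (a : 'rV['F_2]_g -> 'rV[int]_g).

Definition Dset (alpha : 'cV['F_2]_g) : {set 'rV['F_2]_g} :=
  [set e in csupp Q | pairing e alpha == 1].

Definition cocircuit D : bool :=
  minset (fun B => [exists alpha : 'cV['F_2]_g, (alpha != 0) && (B == Dset alpha)]) D.

Definition shortest_for D (x : 'cV[int]_g) : Prop :=
  Dset (parity x) = D /\ quadZ Q x = vonorm Q (parity x).

Definition in_Le r (e : 'rV['F_2]_g) (x : 'cV[int]_g) : Prop :=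
  inIntSpan (in_tuple [seq r D | D <- enum [set D | cocircuit D && (e \notin D)]]) x.

Definition primitive_covector (c : 'rV[int]_g) : Prop :=
  forall (k : int) (b : 'rV[int]_g), c = k *: b -> `|k| = 1.

(* r chooses the vectors r_D and a the covectors a_e; both choices are only
   determined up to signs. *)
Definition reconstruction r a : Prop :=
  (forall D, cocircuit D -> shortest_for D (r D)) /\
  (forall e, e \in csupp Q ->
     primitive_covector (a e) /\
     forall x : 'cV[int]_g, a e *m x = 0 <-> in_Le r e x).

Definition coedge_mx a : 'M[int]_(g, #|csupp Q|) :=
  \matrix_(i, j) a (enum_val j) 0 i.

Definition conorm_row : 'rV[R]_#|csupp Q| := \row_j conorm Q (enum_val j).

(* Deleting the bridges of Gamma and aggregating the remaining coedges by their
   mod-2 class yields the coedges a_e, up to sign, with lengths lambda_e. *)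
Definition aggregates_to a (Gamma : metric_graph R)
    (phi : {additive 'cV[int]_g -> {ffun edge Gamma -> int}}) : Prop :=
  [/\ [set coparity (coedge phi f) | f in [pred f | ~~ bridge f]] = csupp Q,
      forall e, e \in csupp Q ->
        conorm Q e =
        \sum_(f | ~~ bridge f && (coparity (coedge phi f) == e)) len f &
      forall f, ~~ bridge f ->
        coedge phi f = a (coparity (coedge phi f)) \/
        coedge phi f = - a (coparity (coedge phi f))].

(* Q is the period form of a graph whose edges are matched with E by sigma, with
   lengths lambda_e; in the basis of H_1 given by phi, the coedge matrix is
   (a_e)_e up to signs and permutation of the columns. *)
Definition graph_period_certificate a : Prop :=
  exists (Gamma : metric_graph R)
    (phi : {additive 'cV[int]_g -> {ffun edge Gamma -> int}})
    (sigma : edge Gamma -> 'rV['F_2]_g),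
    [/\ realizes Q phi,
        injective sigma,
        sigma @: [set: edge Gamma] = csupp Q,
        forall f, len f = conorm Q (sigma f) &
        forall f, coedge phi f = a (sigma f) \/ coedge phi f = - a (sigma f)].

End Reconstruction.

(* Main.v *)
From HB Require Import structures.
Require Import Defs.
From mathcomp Require Import all_boot all_order all_algebra.
From mathcomp Require Import boolp classical_sets reals.
From mathcomp Require Import fintype finset.
From mathcomp Require Import ring lra zify.

Set Implicit Arguments.
Unset Strict Implicit.
Unset Printing Implicit Defensive.

Import Order.TTheory GRing.Theory Num.Theory.
Local Open Scope ring_scope.

(** A graph enters the picture through one fact: every integral cycle is congruent
    modulo two to a cycle with coordinates 0, 1 and -1 ([unit_lift]).  Hence, if
    [Q] is the period form of a graph, the vonorm of a class is the total length
    of the edges on which the class is odd ([vonorm_period]).  Expansions of the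
    vonorms as sums over sets [e(alpha) = 1] are unique by Fourier inversion
    ([conorm_unique]), so the conorms are the total lengths of the nonzero
    classes of coedges.  They are therefore nonnegative, and their support is the set of
    classes of coedges that are not bridges.  Sums of coedges vanish modulo two
    exactly over cuts ([orthogonal_cut]), which makes the support cographic
    ([csupp_cographic]): edges other than one representative of each class are
    contracted.

    For the converse, Fourier inversion turns the vonorm of [alpha] into the total
    conorm of [D(alpha)].  Comparing [Q] on [x + y] and [x - y] with the vonorm of
    their common class bounds the inner product of two shortest vectors by the
    mass of the common part of their supports ([bilZ_le_mass]).  For two
    fundamental cycles of a graph with cographic matroid [M(E)] the bound is
    attained ([shortest_pair]), and for three of them with a common edge the
    product of the inner products is positive ([shortest_triple]).  What remains
    is a choice of signs.  Here the spanning tree matters: if it is normal, i.e.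
    every edge of the graph joins a vertex to one of its ancestors, the
    fundamental cycles are directed cycles for one orientation of the graph, and
    the signs can be chosen one chord after the other, from the root downwards,
    without conflict ([directed_fundamental_cycles], [sign_choice]).  The chosen
    shortest vectors then have the Gram matrix of the directed fundamental
    cycles, so the lattice they span is the first homology of the graph with its
    period form.  By [unit_lift] this lattice contains a shortest vector of every
    class, and [halving_descent] shows that it is all of [L] ([comb_onto]).

    In any realization a shortest vector has coordinates 0, 1 and -1
    ([shortest_unit]), so the coedges with class outside of [D] vanish on
    [r_D], and [L_e] lies in the kernel of each coedge of class [e].  Two
    primitive covectors with nested kernels agree up to sign
    ([primitive_kernel]), so the coedges of all realizations are the
    reconstructed ones.  Conversely the kernel of a coedge of class [e] is spanned
    by the [r_D] with [e] outside of [D], by the same descent, because the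
    support of a class is a disjoint union of cocircuits ([shortest_Le]). *)

(** * Positive-definite forms on a lattice *)

Section Bilinear.
Variables (R : realType) (g : nat) (Q : 'M[R]_g).
Implicit Types x y z : 'cV[int]_g.

Definition bilZ x y : R := scalar_of ((map_mx intr x)^T *m Q *m map_mx intr y).

Lemma quadZ_bil x : quadZ Q x = bilZ x x. Proof. by []. Qed.

Lemma bilZDl x y z : bilZ (x + y) z = bilZ x z + bilZ y z.
Proof. by rewrite /bilZ /scalar_of map_mxD linearD /= !mulmxDl mxE. Qed.

Lemma bilZDr x y z : bilZ z (x + y) = bilZ z x + bilZ z y.
Proof. by rewrite /bilZ /scalar_of map_mxD mulmxDr mxE. Qed.

Lemma bilZNl x y : bilZ (- x) y = - bilZ x y.
Proof. by rewrite /bilZ /scalar_of map_mxN linearN /= !mulNmx mxE. Qed.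

Lemma bilZNr x y : bilZ x (- y) = - bilZ x y.
Proof. by rewrite /bilZ /scalar_of map_mxN mulmxN mxE. Qed.

Lemma bilZ0l x : bilZ 0 x = 0.
Proof. by apply: (addrI (bilZ 0 x)); rewrite -bilZDl !addr0. Qed.

Lemma quadZN x : quadZ Q (- x) = quadZ Q x.
Proof. by rewrite !quadZ_bil bilZNl bilZNr opprK. Qed.

Lemma quadZ0 : quadZ Q 0 = 0.
Proof. exact: bilZ0l. Qed.

Hypothesis posQ : posdef_form Q.

Lemma bilZC x y : bilZ x y = bilZ y x.
Proof.
rewrite /bilZ /scalar_of.
have := congr1 (fun M : 'M_1 => M 0 0)
  (trmx_mul ((map_mx intr x)^T *m Q) (map_mx intr y)).
by rewrite mxE => ->; rewrite trmx_mul trmxK posQ.1 mulmxA.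
Qed.

Lemma quadZD x y : quadZ Q (x + y) = quadZ Q x + quadZ Q y + 2 * bilZ x y.
Proof. by rewrite !quadZ_bil bilZDl !bilZDr (bilZC y x); ring. Qed.

Lemma map_intr_eq0 x : (map_mx intr x == 0 :> 'cV[R]_g) = (x == 0).
Proof.
apply/eqP/eqP => [H | ->]; last by rewrite map_mx0.
apply/matrixP => i j; have /matrixP/(_ i j) := H; rewrite !mxE => /eqP.
by rewrite intr_eq0 => /eqP.
Qed.

Lemma quadZ_gt0 x : x != 0 -> 0 < quadZ Q x.
Proof. by move=> x0; apply: posQ.2; rewrite map_intr_eq0. Qed.

Lemma quadZ_ge0 x : 0 <= quadZ Q x.
Proof.
by have [->|/quadZ_gt0/ltW//] := eqVneq x 0; rewrite quadZ0.
Qed.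

Lemma quadZ_eq0 x : quadZ Q x = 0 -> x = 0.
Proof.
by move=> H; apply/eqP/negPn/negP => /quadZ_gt0; rewrite H ltxx.
Qed.

(** Cauchy-Schwarz against the vectors of the dual basis bounds each coordinate
    of a vector by its norm, so that every ball contains finitely many lattice
    vectors. *)
Lemma coord_bound :
  exists2 C : R, 0 < C & forall x i, ((x i 0)%:~R) ^+ 2 <= C * quadZ Q x.
Proof.
have Qu : Q \in unitmx.
  rewrite -row_free_unit -kermx_eq0; apply/eqP/row_matrixP => i; rewrite row0.
  apply/eqP/negPn/negP => ki0.
  have := posQ.2 (row i (kermx Q))^T; rewrite /quad /scalar_of trmxK.
  have -> : row i (kermx Q) *m Q = 0 by rewrite -row_mul mulmx_ker row0.
  rewrite mul0mx mxE ltxx => contr; suff /contr : (row i (kermx Q))^T != 0 by [].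
  by apply: contra ki0 => /eqP/(congr1 trmx); rewrite trmxK trmx0 => ->.
pose b (x y : 'cV[R]_g) : R := (x^T *m Q *m y) 0 0.
pose u i : 'cV[R]_g := invmx Q *m delta_mx i 0.
have bC (x y : 'cV[R]_g) : b x y = b y x.
  have := congr1 (fun M : 'M_1 => M 0 0) (trmx_mul (x^T *m Q) y).
  by rewrite mxE /b => ->; rewrite trmx_mul trmxK posQ.1 mulmxA.
have bu i (x : 'cV[R]_g) : b x (u i) = x i 0.
  rewrite /b /u -mulmxA [Q *m _]mulmxA mulmxV // mul1mx mxE (bigD1 i) //=.
  rewrite big1 ?addr0 => [|j ji]; first by rewrite !mxE !eqxx mulr1.
  by rewrite !mxE (negPf ji) mulr0.
have bD (x y : 'cV[R]_g) t : b (x + t *: y) (x + t *: y) = b x x + 2 * t * b x y + t ^+ 2 * b y y.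
  have eT : (x + t *: y)^T = x^T + t *: y^T by rewrite linearD linearZ.
  rewrite /b eT !mulmxDl !mulmxDr -!scalemxAl -!scalemxAr.
  have eD (M N : 'M[R]_1) : (M + N) 0 0 = M 0 0 + N 0 0 by rewrite mxE.
  have eZ (s : R) (M : 'M[R]_1) : (s *: M) 0 0 = s * M 0 0 by rewrite mxE.
  rewrite !eD !eZ.
  by have := bC x y; rewrite /b => ->; ring.
have b_ge0 (x : 'cV[R]_g) : 0 <= b x x.
  have [->|/posQ.2/ltW//] := eqVneq x 0; first by rewrite /b trmx0 !mul0mx mxE.

exists (1 + \sum_i b (u i) (u i)) => [|x i].
  by rewrite ltr_pwDl ?ltr01// sumr_ge0.
have le_sum : b (u i) (u i) <= \sum_i b (u i) (u i).
  by rewrite (bigD1 i) //= lerDl sumr_ge0.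
set X : 'cV[R]_g := map_mx intr x.
rewrite -[quadZ Q x]/(b X X).
have eX : (x i 0)%:~R = X i 0 by rewrite mxE.
rewrite eX; set c := X i 0.
have b0 := b_ge0 X; have u0 := b_ge0 (u i).
(* The form is nonnegative at the point of the line X + R (u i) closest to 0. *)
have cs : c ^+ 2 <= b (u i) (u i) * b X X.
  have [uz|unz] := eqVneq (b (u i) (u i)) 0.
    suff -> : c = 0 by rewrite expr0n /= uz mul0r.
    rewrite /c -(bu i X).
    have [->|] := eqVneq (u i) 0; first by rewrite /b mulmx0 mxE.
    by move/posQ.2; rewrite /quad -[scalar_of _]/(b (u i) (u i)) uz ltxx.
  have := b_ge0 (X + (- c / b (u i) (u i)) *: u i).
  rewrite bD (bu i X) -/c => H.
  have up : 0 < b (u i) (u i) by rewrite lt_neqAle eq_sym unz u0.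
  have := mulr_ge0 (ltW up) H.
  have -> : b (u i) (u i) * (b X X + 2 * (- c / b (u i) (u i)) * c +
     (- c / b (u i) (u i)) ^+ 2 * b (u i) (u i))
     = b (u i) (u i) * b X X - c ^+ 2 by field.
  by rewrite subr_ge0.
by apply: (le_trans cs); apply: ler_wpM2r => //; rewrite ler_wpDl.
Qed.

Lemma quadZ_lbound : exists2 m : R, 0 < m & forall x, quadZ Q x < m -> x = 0.
Proof.
have [C C0 HC] := coord_bound; exists C^-1 => [|x]; first by rewrite invr_gt0.
rewrite -(ltr_pM2l C0) mulfV ?gt_eqF// => H.
apply/matrixP => i j; rewrite (ord1 j) [RHS]mxE.
apply/eqP/negPn/negP => xi0.
have := le_lt_trans (HC x i) H; apply/negP; rewrite -leNgt.
rewrite -rmorphXn /= ler1z -gtz0_ge1.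
by rewrite exprn_even_gt0 //=.
Qed.

(** The vectors of norm at most that of [x0] have coordinates in a bounded
    range, hence are the values of a map from a finite type. *)
Lemma least_vector (P : 'cV[int]_g -> Prop) x0 : P x0 ->
  exists2 x, P x & forall y, P y -> quadZ Q x <= quadZ Q y.
Proof.
move=> Px0; have [C C0 HC] := coord_bound.
pose N := (Num.truncn (C * quadZ Q x0)).+1.
(* The coordinates of a vector that is no longer than x0 lie in [-N, N]. *)
pose vec (k : {ffun 'I_g -> 'I_(2 * N).+1}) : 'cV[int]_g :=
  \col_i ((k i)%:Z - N%:Z).
have vecP y : quadZ Q y <= quadZ Q x0 -> exists k, vec k = y.
  move=> le_y.
  have bd i : `|y i 0| <= N%:Z.
    have h1 : ((y i 0)%:~R : R) ^+ 2 < (N%:Z)%:~R.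
      apply: (le_lt_trans (HC y i)); apply: (@le_lt_trans _ _ (C * quadZ Q x0)).
        by rewrite ler_pM2l.
      rewrite /N -pmulrn; apply: truncnS_gt.
    move: h1; rewrite -rmorphXn /= ltr_int => h1.
    have h2 : `|y i 0| <= `|y i 0| ^+ 2.
      have [->|n0] := eqVneq (y i 0) 0; first by rewrite normr0 expr0n.
      by rewrite expr2 ler_peMl // -gtz0_ge1 normr_gt0.
    apply: (le_trans h2); rewrite real_normK ?num_real //; exact: ltW.
  have lt i : (absz (y i 0 + N%:Z)%R < (2 * N).+1)%N.
    have := bd i; rewrite ler_norml => /andP[h1 h2].
    rewrite ltnS -lez_nat gez0_abs; last by rewrite addrC -lerBlDl sub0r.
    by rewrite mul2n -addnn PoszD lerD2r.
  exists [ffun i => Ordinal (lt i)]; apply/matrixP => i j.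
  rewrite mxE ffunE /= (ord1 j) gez0_abs ?addrK //.
  have := bd i; rewrite ler_norml => /andP[h1 _].
  by rewrite addrC -lerBlDl sub0r.
have [k0 Ek0] := vecP x0 (lexx _).
have Pk0 : `[< P (vec k0) >] by apply/asboolP; rewrite Ek0.
case: (@Order.TotalTheory.arg_minP _ _ _ k0 (fun k => `[< P (vec k) >])
   (fun k => quadZ Q (vec k)) Pk0) => k /asboolP Pk Hk.
exists (vec k) => // y Py.
have [le_y|/ltW lt_y] := lerP (quadZ Q y) (quadZ Q x0).
  by have [k' Ek'] := vecP y le_y; rewrite -Ek'; apply: Hk; apply/asboolP; rewrite Ek'.
by apply: le_trans lt_y; rewrite -Ek0; apply: Hk.
Qed.

End Bilinear.

(** * Arithmetic modulo two *)

Lemma F2_pchar : 2%N \in [pchar 'F_2]. Proof. exact: pchar_Fp. Qed.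

Lemma F2_addxx (u : 'F_2) : u + u = 0.
Proof. exact: (addrr_pchar2 F2_pchar). Qed.

Lemma F2_opp (u : 'F_2) : - u = u.
Proof. exact: (oppr_pchar2 F2_pchar). Qed.

Lemma F2_case (u : 'F_2) : u = 0 \/ u = 1.
Proof. by case: u => [[|[|//]]] i; [left|right]; apply/val_inj. Qed.

Lemma F2_neq0 (u : 'F_2) : (u != 0) = (u == 1).
Proof. by have [->|->] := F2_case u. Qed.

Lemma F2_eqb (u : 'F_2) : u = (u == 1)%:R.
Proof. by have [->|->] := F2_case u. Qed.

Lemma intr_F2 (n : int) : n%:~R = (odd `|n|)%:R :> 'F_2.
Proof.
have nat_F2 m : m%:R = (odd m)%:R :> 'F_2.
  by rewrite -{1}(odd_double_half m) natrD -addnn natrD F2_addxx addr0.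
by case: n => m; rewrite ?NegzE ?mulrNz ?F2_opp ?abszN -pmulrn [LHS]nat_F2.
Qed.

Lemma matrix_F2_addxx m n (M : 'M['F_2]_(m, n)) : M + M = 0.
Proof. by apply/matrixP => i j; rewrite !mxE F2_addxx. Qed.

Lemma matrix_F2_opp m n (M : 'M['F_2]_(m, n)) : - M = M.
Proof. by apply/matrixP => i j; rewrite !mxE F2_opp. Qed.

Lemma eq_F2_double (a b : int) : a%:~R = b%:~R :> 'F_2 -> exists c, a - b = c + c.
Proof.
move=> H; have : ((a - b)%:~R : 'F_2) = 0 by rewrite rmorphB /= H subrr.
rewrite intr_F2 => oddab; exists ((a - b) %/ 2)%Z.
have {oddab} : ~~ odd `|a - b| by case: (odd _) oddab.
lia.
Qed.

Section Parity.
Variable g : nat.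
Implicit Types (x y z : 'cV[int]_g) (e : 'rV['F_2]_g) (alpha beta : 'cV['F_2]_g).

Lemma parityD x y : parity (x + y) = parity x + parity y.
Proof. exact: map_mxD. Qed.

Lemma parityN x : parity (- x) = parity x.
Proof. by rewrite /parity map_mxN matrix_F2_opp. Qed.

Lemma parity0 : parity (0 : 'cV[int]_g) = 0.
Proof. exact: map_mx0. Qed.

Lemma parity_surj alpha : exists x, parity x = alpha.
Proof.
exists (\col_i (alpha i 0 : nat)%:Z); apply/matrixP => i j.
by rewrite !mxE (ord1 j) -pmulrn natr_Zp.
Qed.

Lemma parity_eqP x y : parity x = parity y -> exists z, x - y = z + z.
Proof.
move=> H; have h i : exists c, x i 0 - y i 0 = c + c.
  by apply: eq_F2_double; have /matrixP/(_ i 0) := H; rewrite !mxE.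
have [c Hc] := choice h; exists (\col_i c i); apply/matrixP => i j.
by rewrite (ord1 j) !mxE Hc.
Qed.

Lemma pairingDr e alpha beta :
  pairing e (alpha + beta) = pairing e alpha + pairing e beta.
Proof. by rewrite /pairing /scalar_of mulmxDr mxE. Qed.

Lemma pairingDl e e' alpha :
  pairing (e + e') alpha = pairing e alpha + pairing e' alpha.
Proof. by rewrite /pairing /scalar_of mulmxDl mxE. Qed.

Lemma pairing0l alpha : pairing 0 alpha = 0.
Proof. by rewrite /pairing mul0mx /scalar_of mxE. Qed.

Lemma pairing0r e : pairing e 0 = 0.
Proof. by rewrite /pairing mulmx0 /scalar_of mxE. Qed.

Lemma pairing_suml (I : Type) (s : seq I) (P : pred I) (E : I -> 'rV['F_2]_g) alpha :
  pairing (\sum_(i <- s | P i) E i) alpha = \sum_(i <- s | P i) pairing (E i) alpha.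
Proof. by rewrite /pairing /scalar_of mulmx_suml summxE. Qed.

Lemma pairing_sumr (I : Type) (s : seq I) (P : pred I) (E : I -> 'cV['F_2]_g) e :
  pairing e (\sum_(i <- s | P i) E i) = \sum_(i <- s | P i) pairing e (E i).
Proof. by rewrite /pairing /scalar_of mulmx_sumr summxE. Qed.

Lemma pairing_delta e i : pairing e (delta_mx i 0) = e 0 i.
Proof.
rewrite /pairing /scalar_of mxE (bigD1 i) //= big1 ?addr0 => [|j ji].
  by rewrite mxE !eqxx mulr1.
by rewrite mxE (negPf ji) mulr0.
Qed.

Lemma pairing_delta_row alpha i : pairing (delta_mx 0 i) alpha = alpha i 0.
Proof.
rewrite /pairing /scalar_of mxE (bigD1 i) //= big1 ?addr0 => [|j ji].
  by rewrite mxE !eqxx mul1r.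
by rewrite mxE (negPf ji) mul0r.
Qed.

Lemma covector_ext e e' : (forall alpha, pairing e alpha = pairing e' alpha) -> e = e'.
Proof.
move=> H; apply/matrixP => i j; rewrite (ord1 i).
by rewrite -!pairing_delta H.
Qed.

Lemma sum_character (R : realType) (T : finZmodType) (f : T -> 'F_2) :
  (forall u v, f (u + v) = f u + f v) -> (exists u, f u = 1) ->
  \sum_u (-1) ^+ (f u : nat) = 0 :> R.
Proof.
move=> fD [u0 fu0]; set S := \sum_u _.
have : S = - S.
  rewrite {1}/S (reindex_inj (addrI u0)) /= -sumrN; apply: eq_bigr => u _.
  by rewrite fD fu0; have [->|->] := F2_case (f u); rewrite /= ?expr0 ?expr1 ?opprK.
by move=> /eqP; rewrite -subr_eq0 opprK -mulr2n mulrn_eq0 /= => /eqP.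
Qed.

End Parity.

(** * Vonorms, conorms and Fourier inversion *)

Section Fourier.
Variables (R : realType) (g : nat).
Implicit Types (e : 'rV['F_2]_g) (alpha beta : 'cV['F_2]_g).

Definition chi (u : 'F_2) : R := (-1) ^+ (u : nat).

Lemma chiD u v : chi (u + v) = chi u * chi v.
Proof.
have [->|->] := F2_case u; first by rewrite add0r /chi expr0 mul1r.
have [->|->] := F2_case v; first by rewrite addr0 /chi expr0 mulr1.
by rewrite F2_addxx /chi expr0 expr1 mulrNN mulr1.
Qed.

Lemma chi_ind u : (u == 1)%:R = (1 - chi u) / 2 :> R.
Proof.
have [->|->] := F2_case u; rewrite /chi ?expr0 ?expr1; first by rewrite subrr mul0r.
by rewrite eqxx opprK -[1 + 1]/(2%:R) divff ?pnatr_eq0.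
Qed.

Lemma sum_chi_vectors e : \sum_alpha chi (pairing e alpha) = (2 ^+ g) * (e == 0)%:R.
Proof.
have [->|e0] := eqVneq e 0.
  under eq_bigr do rewrite pairing0l /chi expr0.
  by rewrite sumr_const card_mx card_Fp // muln1 mulr1 -natrX.
rewrite mulr0; apply: sum_character => [u v|]; first exact: pairingDr.
have [i ei] : exists i, e 0 i != 0.
  apply/existsP; apply: contraNT e0 => /existsPn H; apply/eqP/matrixP => i j.
  by rewrite (ord1 i) mxE; apply/eqP/negPn/H.
by exists (delta_mx i 0); rewrite pairing_delta; apply/eqP; rewrite -F2_neq0.
Qed.

Lemma sum_chi_covectors alpha :
  \sum_e chi (pairing e alpha) = (2 ^+ g) * (alpha == 0)%:R.
Proof.
have [->|a0] := eqVneq alpha 0.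
  under eq_bigr do rewrite pairing0r /chi expr0.
  by rewrite sumr_const card_mx card_Fp // mul1n mulr1 -natrX.
rewrite mulr0; apply: sum_character => [u v|]; first exact: pairingDl.
have [i ai] : exists i, alpha i 0 != 0.
  apply/existsP; apply: contraNT a0 => /existsPn H; apply/eqP/matrixP => i j.
  by rewrite (ord1 j) mxE; apply/eqP/negPn/H.
by exists (delta_mx 0 i); rewrite pairing_delta_row; apply/eqP; rewrite -F2_neq0.
Qed.

Lemma addr_F2_eq0 m n (u v : 'M['F_2]_(m, n)) : (u + v == 0) = (u == v).
Proof. by rewrite -{1}(matrix_F2_opp v) subr_eq0. Qed.

Lemma two_pow_conorm : 2 ^ (1 - g%:Z) * 2 ^+ g = 2 :> R.
Proof.
rewrite -[_ ^+ g]/(2 ^ (g%:Z)) -expfzDr ?pnatr_eq0 //.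
by rewrite subrK expr1z.
Qed.

Variable Q : 'M[R]_g.

(** The indicators of the nonzero covectors have pairwise orthogonal Fourier
    transforms away from the trivial character, so the weights in such an
    expansion of the vonorm function can be read off from it. *)
Lemma conorm_unique (w : 'rV['F_2]_g -> R) e : e != 0 ->
  (forall alpha, vonorm Q alpha = \sum_(e' | pairing e' alpha == 1) w e') ->
  conorm Q e = w e.
Proof.
move=> e0 Hw; rewrite /conorm.
have -> : \sum_alpha (-1) ^+ (pairing e alpha : nat) * vonorm Q alpha
   = \sum_e' w e' * \sum_alpha chi (pairing e alpha) * (pairing e' alpha == 1)%:R.
  under [RHS]eq_bigr do rewrite big_distrr /=.
  rewrite exchange_big /=; apply: eq_bigr => alpha _.
  rewrite Hw big_mkcond big_distrr /=; apply: eq_bigr => e' _.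
  by case: eqP; rewrite -/(chi _) ?mulr0 ?mulr1 // mulrC.
have -> : \sum_e' w e' * \sum_alpha chi (pairing e alpha) * (pairing e' alpha == 1)%:R
   = \sum_e' w e' * (- (2 ^+ g / 2) * (e == e')%:R).
  apply: eq_bigr => e' _; congr (_ * _).
  under eq_bigr do rewrite chi_ind mulrA mulrBr mulr1 -chiD -pairingDl.
  rewrite -big_distrl /= sumrB !sum_chi_vectors (negPf e0) mulr0 sub0r addr_F2_eq0.
  by rewrite !mulNr mulrAC.
rewrite (bigD1 e) //= eqxx big1 ?addr0 => [|e' /negPf]; last first.
  by rewrite eq_sym => ->; rewrite !mulr0.
have := two_pow_conorm; set A := 2 ^ _; set B := 2 ^+ g => AB.
have -> : - (A * (w e * (- (B / 2) * true%:R))) = (A * B) * w e / 2 by rewrite mulr1; field.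
by rewrite AB; field.
Qed.

(** The indicators vanish at the class 0, so they can only expand differences with the
    vonorm of that class. *)
Lemma vonorm_inversion alpha :
  vonorm Q alpha - vonorm Q 0 = \sum_(e | pairing e alpha == 1) conorm Q e.
Proof.
rewrite big_mkcond /=.
pose A : R := 2 ^ (1 - g%:Z).
have -> : \sum_e (if pairing e alpha == 1 then conorm Q e else 0)
  = - A * \sum_beta vonorm Q beta *
       \sum_e chi (pairing e beta) * (pairing e alpha == 1)%:R.
  rewrite mulNr -mulrN -sumrN big_distrr /=.
  under [RHS]eq_bigr do rewrite big_distrr /= -sumrN big_distrr /=.
  rewrite exchange_big /=; apply: eq_bigr => e _.
  rewrite /conorm -/A -/(chi _); case: eqP => _.
    rewrite -mulrN -sumrN big_distrr /=; apply: eq_bigr => beta _.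
    by rewrite mulr1 -/(chi _) [_ * vonorm _ _]mulrC.
  by rewrite big1 // => beta _; rewrite !mulr0 oppr0 mulr0.
have -> : \sum_beta vonorm Q beta * \sum_e chi (pairing e beta) * (pairing e alpha == 1)%:R
  = \sum_beta vonorm Q beta * ((2 ^+ g / 2) * ((beta == 0)%:R - (beta == alpha)%:R)).
  apply: eq_bigr => beta _; congr (_ * _).
  under eq_bigr do rewrite chi_ind mulrA mulrBr mulr1 -chiD -pairingDr.
  rewrite -big_distrl /= sumrB !sum_chi_covectors addr_F2_eq0 -mulrBr.
  by rewrite mulrAC.
have -> : \sum_beta vonorm Q beta * ((2 ^+ g / 2) * ((beta == 0)%:R - (beta == alpha)%:R))
  = (2 ^+ g / 2) * (vonorm Q 0 - vonorm Q alpha).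
  have ev (b0 : 'cV['F_2]_g) : vonorm Q b0 = \sum_beta vonorm Q beta * (beta == b0)%:R.
    rewrite (bigD1 b0) //= eqxx mulr1 big1 ?addr0 // => b /negPf ->.
    by rewrite mulr0.
  rewrite (ev 0) (ev alpha) -sumrB big_distrr /=; apply: eq_bigr => b _.
  by ring.
have := two_pow_conorm; rewrite -/A; set B := 2 ^+ g => AB.
set u := vonorm _ _; set v := vonorm _ _.
have -> : - A * (B / 2 * (v - u)) = (A * B) * (u - v) / 2 by field.
by rewrite AB; field.
Qed.

End Fourier.

Section Vonorms.
Variables (R : realType) (g : nat) (Q : 'M[R]_g).
Hypothesis posQ : posdef_form Q.
Implicit Types (x y z : 'cV[int]_g) (e : 'rV['F_2]_g) (alpha beta : 'cV['F_2]_g).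

Definition shortest x := quadZ Q x = vonorm Q (parity x).

Lemma vonorm_min alpha :
  (exists2 x, parity x = alpha & quadZ Q x = vonorm Q alpha) /\
  (forall x, parity x = alpha -> vonorm Q alpha <= quadZ Q x).
Proof.
have [x0 Px0] := parity_surj alpha.
have [x Px Hx] := least_vector posQ (P := fun x => parity x = alpha) Px0.
rewrite /vonorm /minimum.
set S := [set quadZ Q x | x in _]%classic.
have mem : (S `&` lbound S)%classic (quadZ Q x).
  split; first by exists x.
  by move=> _ [y Py <-]; apply: Hx.
case: xgetP => [s _ [[y Py <-] lb]|/(_ (quadZ Q x))//].
split; first by exists y.
by move=> z Pz; apply: lb; exists z.
Qed.

Lemma vonorm_le x : vonorm Q (parity x) <= quadZ Q x.
Proof. exact: (vonorm_min _).2. Qed.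

Lemma shortest_exists alpha : exists2 x, parity x = alpha & shortest x.
Proof. by have [[x Px Hx] _] := vonorm_min alpha; exists x; rewrite // /shortest Px. Qed.

Lemma vonorm0 : vonorm Q (0 : 'cV_g) = 0.
Proof.
have [x Px Hx] := shortest_exists (0 : 'cV_g).
apply/le_anti/andP; split; first by have := vonorm_le 0; rewrite parity0 quadZ0.
by rewrite -Px -Hx quadZ_ge0.
Qed.

Lemma vonorm_gt0 alpha : alpha != 0 -> 0 < vonorm Q alpha.
Proof.
have [x <- Hx] := shortest_exists alpha; rewrite -Hx => Px.
by apply: quadZ_gt0 => //; apply: contra_neq Px => ->; rewrite parity0.
Qed.

Lemma shortest0 : shortest 0.
Proof. by rewrite /shortest quadZ0 parity0 vonorm0. Qed.

(** Both [x + y] and [x - y] lie in the sum of the two classes. *)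
Lemma bilZ_le_vonorm x y : shortest x -> shortest y ->
  2 * `|bilZ Q x y| <=
  vonorm Q (parity x) + vonorm Q (parity y) - vonorm Q (parity x + parity y).
Proof.
rewrite /shortest => Hx Hy.
have h1 := vonorm_le (x + y); have h2 := vonorm_le (x - y).
rewrite quadZD // ?parityD Hx Hy in h1.
rewrite quadZD // quadZN bilZNr parityD parityN Hx Hy in h2.
by case: (ger0P (bilZ Q x y)) => _; lra.
Qed.

(** If [y] is congruent to [x] modulo two and not longer, then one of
    [(x - y) / 2] and [(x + y) / 2] has at most half of the norm of [x]; as
    norms of nonzero lattice vectors are bounded below, iterating this writes
    [x] as a combination of such vectors [y]. *)
Lemma halving_descent (K K' : 'cV[int]_g -> Prop) :
  K 0 -> (forall x y, K x -> K y -> K (x - y)) ->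
  (forall x y z, K' x -> K y -> x - y = z + z -> K' z) ->
  (forall x, K' x -> exists y, [/\ K y, parity y = parity x & quadZ Q y <= quadZ Q x]) ->
  forall x, K' x -> K x.
Proof.
move=> K0 KB Kh Kex; have KN x : K x -> K (- x) by move=> Kx; rewrite -sub0r; apply: KB.
have KD x y : K x -> K y -> K (x + y).
  by move=> Kx Ky; rewrite -[y]opprK; apply: KB => //; apply: KN.
have [m m0 Hm] := quadZ_lbound posQ.
suff H n : forall x, K' x -> quadZ Q x < 2 ^+ n * m -> K x.
  move=> x K'x; pose n := (Num.truncn (quadZ Q x / m)).+1.
  apply: (H n) => //; rewrite -ltr_pdivrMr //.
  apply: (lt_le_trans (truncnS_gt _)); rewrite -natrX ler_nat ltnW //.
  exact: ltn_expl.
elim: n => [|n IHn] x K'x.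
  by rewrite expr0 mul1r => /Hm ->.
move=> lt_x; have [y [Ky Pyx le_yx]] := Kex x K'x.
have par : quadZ Q (x - y) + quadZ Q (x - - y) = 2 * (quadZ Q x + quadZ Q y).
  by rewrite !quadZD // !bilZNr !quadZN; ring.
have half y' : K y' -> parity y' = parity x -> quadZ Q (x - y') <= 2 * quadZ Q x -> K x.
  move=> Ky' Py' le; have [z Hz] := parity_eqP (esym Py').
  have -> : x = y' + (z + z) by rewrite -Hz addrC subrK.
  suff Kz : K z by apply/KD => //; apply/KD.
  apply: IHn; first exact: Kh Hz.
  move: le; rewrite Hz quadZD // -quadZ_bil; move: lt_x; rewrite exprS -mulrA.
  lra.
have [le1|lt1] := lerP (quadZ Q (x - y)) (2 * quadZ Q x); first exact: half le1.
apply: (half (- y)); rewrite ?parityN //; first exact: KN.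
move: par lt1 le_yx; lra.
Qed.

End Vonorms.

(** * Inner products of shortest vectors *)

Section ShortestVectors.
Variables (R : realType) (g : nat) (Q : 'M[R]_g).
Hypothesis posQ : posdef_form Q.
Hypothesis ge0Q : conorms_ge0 Q.
Implicit Types (x y z : 'cV[int]_g) (e : 'rV['F_2]_g) (alpha beta : 'cV['F_2]_g).
Implicit Types S : {set 'rV['F_2]_g}.

Definition mass S : R := \sum_(e in S) conorm Q e.

Definition hit e alpha : R := locked (pairing e alpha == 1)%:R.

Lemma hitE e alpha : (pairing e alpha == 1)%:R = hit e alpha.
Proof. by rewrite /hit -lock. Qed.

Lemma hit_if e alpha (c : R) : (if pairing e alpha == 1 then c else 0) = c * hit e alpha.
Proof. by rewrite -hitE; case: eqP; rewrite ?mulr1 ?mulr0. Qed.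

Lemma hit01 e alpha : hit e alpha = 0 \/ hit e alpha = 1.
Proof. by rewrite -hitE; case: eqP; [right|left]. Qed.

Lemma in_Dset e alpha : (e \in Dset Q alpha) = (e \in csupp Q) && (pairing e alpha == 1).
Proof. by rewrite !inE. Qed.

Local Opaque Dset.

Lemma conorm_gt0 e : e \in csupp Q -> 0 < conorm Q e.
Proof. by rewrite inE => /andP[]. Qed.

Lemma vonorm_indicator alpha :
  vonorm Q alpha = \sum_(e in csupp Q) conorm Q e * hit e alpha.
Proof.
have := vonorm_inversion Q alpha; rewrite vonorm0 // subr0 => ->.
rewrite big_mkcond [RHS]big_mkcond; apply: eq_bigr => e _.
rewrite hit_if -hitE; case: eqP => [pe|_]; last by rewrite mulr0 if_same.
rewrite mulr1 inE; have [e0|e0] := eqVneq e 0; first by have := pe; rewrite e0 pairing0l.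
rewrite /= lt_neqAle ge0Q // andbT.
by case: eqP => //= <-.
Qed.

Lemma mass_filter S (P : pred 'rV['F_2]_g) (f : 'rV['F_2]_g -> R) :
  (forall e, (e \in S) = (e \in csupp Q) && P e) -> (forall e, f e = (P e)%:R) ->
  mass S = \sum_(e in csupp Q) conorm Q e * f e.
Proof.
move=> HS Hf; rewrite /mass [LHS]big_mkcond [RHS]big_mkcond.
apply: eq_bigr => e _; rewrite HS Hf; case: (e \in csupp Q) => //=.
by case: (P e); rewrite ?mulr1 ?mulr0.
Qed.

Lemma massE alpha : vonorm Q alpha = mass (Dset Q alpha).
Proof.
rewrite vonorm_indicator; apply/esym/mass_filter; first by move=> e; apply: in_Dset.
by move=> e; rewrite -hitE.
Qed.

Lemma mass_ge0 S : S \subset csupp Q -> 0 <= mass S.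
Proof. by move=> /subsetP sub; apply: sumr_ge0 => e /sub/conorm_gt0/ltW. Qed.

Lemma mass_gt0 S : S \subset csupp Q -> S != set0 -> 0 < mass S.
Proof.
move=> sub /set0Pn[e eS]; rewrite /mass (bigD1 e) //=.
apply: ltr_wpDr; last by apply/conorm_gt0/(subsetP sub).
by apply: sumr_ge0 => f /andP[/(subsetP sub)/conorm_gt0/ltW].
Qed.

Lemma Dset_sub alpha : Dset Q alpha \subset csupp Q.
Proof. by apply/subsetP => e; rewrite in_Dset => /andP[]. Qed.

Lemma mass_interE alpha beta : mass (Dset Q alpha :&: Dset Q beta) =
  \sum_(e in csupp Q) conorm Q e * (hit e alpha * hit e beta).
Proof.
apply: mass_filter => e; first by rewrite in_setI !in_Dset andbACA andbb.
by rewrite -!hitE mulr_natl mulrb; case: (pairing e alpha == 1).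
Qed.

Lemma hitD e alpha beta :
  hit e (alpha + beta) = hit e alpha + hit e beta - 2 * (hit e alpha * hit e beta).
Proof.
rewrite -!hitE pairingDr; have f01 : (0 == 1 :> 'F_2) = false by [].
have [->|->] := F2_case (pairing e alpha); first by rewrite add0r f01 mulr0n; ring.
have [->|->] := F2_case (pairing e beta); first by rewrite addr0 f01 mulr0n; ring.
by rewrite F2_addxx eqxx f01 mulr0n mulr1n; ring.
Qed.

Lemma vonormD alpha beta : vonorm Q (alpha + beta) =
  vonorm Q alpha + vonorm Q beta - 2 * mass (Dset Q alpha :&: Dset Q beta).
Proof.
rewrite mass_interE !vonorm_indicator big_distrr -big_split -sumrB /=.
by apply: eq_bigr => e _; rewrite hitD; ring.
Qed.

Lemma Dset_eq0 alpha : Dset Q alpha = set0 -> alpha = 0.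
Proof.
move=> D0; apply/eqP/negPn/negP => /(vonorm_gt0 posQ).
by rewrite massE D0 /mass big_set0 ltxx.
Qed.

Lemma vector_ext_csupp alpha beta :
  (forall e, e \in csupp Q -> pairing e alpha = pairing e beta) -> alpha = beta.
Proof.
move=> H; apply/eqP; rewrite -addr_F2_eq0; apply/eqP/Dset_eq0/setP => e.
rewrite in_Dset in_set0; case eE: (e \in csupp Q) => //=.
by rewrite pairingDr H // F2_addxx.
Qed.

Lemma bilZ_le_mass x y : shortest Q x -> shortest Q y ->
  `|bilZ Q x y| <= mass (Dset Q (parity x) :&: Dset Q (parity y)).
Proof.
move=> Hx Hy; have := bilZ_le_vonorm posQ Hx Hy; rewrite vonormD.
lra.
Qed.

(** If [r] is shortest in the sum of the classes of [x] and [y], the four vectors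
    [(r + x + y) / 2 - v], for [v] among [0], [x], [y], [r], are together exactly as
    long as [x], [y] and [r]; the vonorms of their classes allow this only if
    they are all shortest and their classes are supported on the two given
    sets.  Then one of them is in the zero class, hence zero. *)
Lemma shortest_pair x y : shortest Q x -> shortest Q y ->
  (forall beta, Dset Q beta \subset Dset Q (parity x) :|: Dset Q (parity y) ->
     [\/ beta = 0, beta = parity x, beta = parity y | beta = parity x + parity y]) ->
  `|bilZ Q x y| = mass (Dset Q (parity x) :&: Dset Q (parity y)).
Proof.
move=> Hx Hy span.
have [r Pr Hr] := shortest_exists posQ (parity x + parity y).
suff : quadZ Q r = quadZ Q (x + y) \/ quadZ Q r = quadZ Q (x - y).
  have := bilZ_le_mass Hx Hy.
  rewrite Hr Pr vonormD !quadZD // quadZN bilZNr Hx Hy.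
  move=> le; set m := mass _ in le *; set b := bilZ Q x y in le *.
  move=> [E|E].
    have -> : m = - b by move: E; lra.
    by apply: ler0_norm; move: le E; rewrite ler_norml => /andP[]; lra.
  have -> : m = b by move: E; lra.
  by apply: ger0_norm; move: le E; rewrite ler_norml => /andP[]; lra.
have [w Hw] : exists w, r + (x + y) - 0 = w + w.
  apply: parity_eqP; rewrite !parityD Pr parity0 -[RHS](matrix_F2_addxx (parity x + parity y)).
  by [].
rewrite subr0 in Hw.
have rE : r = w + w - (x + y) by rewrite -Hw addrK.
have sumQ : quadZ Q w + quadZ Q (w - x) + quadZ Q (w - y) + quadZ Q (w - r) =
    quadZ Q x + quadZ Q y + quadZ Q r.
  rewrite rE !quadZ_bil !(bilZDl, bilZDr, bilZNl, bilZNr).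
  by rewrite !(bilZC posQ y) !(bilZC posQ x w); ring.
set a := parity x in span Pr *; set b := parity y in span Pr *; set c := parity w.
have Pwx : parity (w - x) = c + a by rewrite parityD parityN.
have Pwy : parity (w - y) = c + b by rewrite parityD parityN.
have Pwr : parity (w - r) = c + (a + b) by rewrite parityD parityN Pr.
have l0 := vonorm_le posQ w; have l1 := vonorm_le posQ (w - x).
have l2 := vonorm_le posQ (w - y); have l3 := vonorm_le posQ (w - r).
rewrite Pwx in l1; rewrite Pwy in l2; rewrite Pwr in l3; rewrite -/c in l0.
have excess : vonorm Q c + vonorm Q (c + a) + vonorm Q (c + b) + vonorm Q (c + (a + b)) =
   vonorm Q a + vonorm Q b + vonorm Q (a + b) +
   4 * mass (Dset Q c :\: (Dset Q a :|: Dset Q b)).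
  have -> : mass (Dset Q c :\: (Dset Q a :|: Dset Q b)) =
    \sum_(e in csupp Q) conorm Q e * (hit e c * (1 - hit e a) * (1 - hit e b)).
    apply: (@mass_filter _ (fun e => [&& pairing e c == 1, pairing e a != 1 & pairing e b != 1])) => e.
      rewrite in_setD in_setU !in_Dset negb_or; case: (e \in csupp Q) => //=.
      by rewrite andbC.
    rewrite -!hitE; case: (pairing e c == 1); case: (pairing e a == 1);
    by case: (pairing e b == 1); rewrite /= ?mulr1n ?mulr0n; ring.
  rewrite !vonorm_indicator big_distrr -!big_split /=; apply: eq_bigr => e _.
  rewrite !hitD.
  by have [->|->] := hit01 e a; have [->|->] := hit01 e b; have [->|->] := hit01 e c; ring.
have subE : Dset Q c :\: (Dset Q a :|: Dset Q b) \subset csupp Q.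
  by apply: subset_trans (Dset_sub c); apply: subsetDl.
have m0 := mass_ge0 subE.
rewrite Hx Hy Hr -/a -/b Pr in sumQ.
have mz : mass (Dset Q c :\: (Dset Q a :|: Dset Q b)) = 0.
  by move: excess sumQ l0 l1 l2 l3 m0; lra.
have subD : Dset Q c \subset Dset Q a :|: Dset Q b.
  rewrite -setD_eq0; apply/negPn/negP => /(mass_gt0 subE).
  by rewrite mz ltxx.
have zero v : quadZ Q v = vonorm Q (parity v) -> parity v = 0 -> v = 0.
  by move=> Qv Pv; apply: (quadZ_eq0 posQ); rewrite Qv Pv vonorm0.
have [c0|ca|cb|cab] := span c subD.
- left; have w0 : w = 0 by apply: zero => //; move: excess sumQ l0 l1 l2 l3 mz; rewrite -/c; lra.
  by rewrite rE w0 add0r add0r quadZN.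
- right; have w0 : w - x = 0.
    apply: zero; last by rewrite Pwx ca matrix_F2_addxx.
    by rewrite Pwx; move: excess sumQ l0 l1 l2 l3 mz; lra.
  by move/eqP: w0; rewrite subr_eq0 => /eqP w0; rewrite rE w0; rewrite opprD addrA addrK.
- right; have w0 : w - y = 0.
    apply: zero; last by rewrite Pwy cb matrix_F2_addxx.
    by rewrite Pwy; move: excess sumQ l0 l1 l2 l3 mz; lra.
  move/eqP: w0; rewrite subr_eq0 => /eqP w0; rewrite rE w0.
  by rewrite opprD (addrC (- x)) addrA addrK -quadZN opprB.
left; have w0 : w - r = 0.
  apply: zero; last by rewrite Pwr cab matrix_F2_addxx.
  by rewrite Pwr; move: excess sumQ l0 l1 l2 l3 mz; lra.
move/eqP: w0; rewrite subr_eq0 => /eqP w0.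
by congr (quadZ Q _); apply: (addrI r); rewrite Hw w0.
Qed.

Lemma vonormD3 a b c : vonorm Q (a + b + c) = vonorm Q a + vonorm Q b + vonorm Q c
   - 2 * (mass (Dset Q a :&: Dset Q b) + mass (Dset Q a :&: Dset Q c)
          + mass (Dset Q b :&: Dset Q c))
   + 4 * mass (Dset Q a :&: Dset Q b :&: Dset Q c).
Proof.
have -> : mass (Dset Q a :&: Dset Q b :&: Dset Q c) =
    \sum_(e in csupp Q) conorm Q e * (hit e a * hit e b * hit e c).
  apply: (@mass_filter _ (fun e => [&& pairing e a == 1, pairing e b == 1 & pairing e c == 1])) => e.
    by rewrite !in_setI !in_Dset; case: (e \in csupp Q) => //=; rewrite andbA.
  rewrite -!hitE; case: (pairing e c == 1); case: (pairing e a == 1);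
  by case: (pairing e b == 1); rewrite /= ?mulr1n ?mulr0n; ring.
rewrite !mass_interE !vonorm_indicator.
rewrite -!big_split !big_distrr /= -!sumrN -!big_split /=.
apply: eq_bigr => e _; rewrite !hitD; ring.
Qed.

Lemma norm_triple_sign (p q r a b c m : R) :
  p != 0 -> q != 0 -> r != 0 -> 0 < m ->
  let bound s t := a + b + c - 2 * (`|p| + `|q| + `|r|) + 4 * m <=
     a + b + c + 2 * (s * p + t * q + s * t * r) in
  bound 1 1 -> bound 1 (-1) -> bound (-1) 1 -> bound (-1) (-1) -> 0 < p * q * r.
Proof.
move=> p0 q0 r0 m0 bound; rewrite /bound !(mul1r, mulN1r, mulrN1, opprK, mulr1).
have pos u : u != 0 -> 0 <= u -> 0 < u by move=> *; rewrite lt_neqAle eq_sym; apply/andP.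
case: (ger0P p) => sp; case: (ger0P q) => sq; case: (ger0P r) => sr b1 b2 b3 b4;
  try (by exfalso; lra).
- by apply: mulr_gt0; [apply: mulr_gt0|]; apply: pos.
- by rewrite -mulrA; apply: mulr_gt0; [apply: pos|rewrite nmulr_rgt0].
- by rewrite nmulr_lgt0 // nmulr_rlt0 //; apply: pos.
- by rewrite pmulr_lgt0 ?nmulr_rgt0 //; apply: pos.
Qed.

(** If the product were negative, suitable signs would make all three inner
    products negative, and the signed sum of the three vectors would undercut the
    vonorm of its class by four times the mass of the common edges. *)
Lemma shortest_triple x y z : shortest Q x -> shortest Q y -> shortest Q z ->
  `|bilZ Q x y| = mass (Dset Q (parity x) :&: Dset Q (parity y)) ->
  `|bilZ Q x z| = mass (Dset Q (parity x) :&: Dset Q (parity z)) ->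
  `|bilZ Q y z| = mass (Dset Q (parity y) :&: Dset Q (parity z)) ->
  Dset Q (parity x) :&: Dset Q (parity y) :&: Dset Q (parity z) != set0 ->
  0 < bilZ Q x y * bilZ Q x z * bilZ Q y z.
Proof.
set a := parity x; set b := parity y; set c := parity z.
move=> Hx Hy Hz Exy Exz Eyz D0.
have sub3 : Dset Q a :&: Dset Q b :&: Dset Q c \subset csupp Q.
  by apply: subset_trans (Dset_sub c); apply: subsetIr.
have m3 := mass_gt0 sub3 D0.
have pos S : S \subset csupp Q -> Dset Q a :&: Dset Q b :&: Dset Q c \subset S -> 0 < mass S.
  move=> sS sub; apply: mass_gt0 => //; apply: contra_neq D0 => S0.
  by apply/eqP; rewrite -subset0 -S0.
have subI u v : Dset Q u :&: Dset Q v \subset csupp Q.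
  by apply: subset_trans (Dset_sub v); apply: subsetIr.
have pxy := pos _ (subI a b) (subsetIl _ _).
have pxz := pos _ (subI a c) (setSI _ (subsetIl _ _)).
have pyz := pos _ (subI b c) (setSI _ (subsetIr _ _)).
have bound x' y' z' : parity x' = a -> parity y' = b -> parity z' = c ->
    vonorm Q (a + b + c) <= quadZ Q x' + quadZ Q y' + quadZ Q z' +
      2 * (bilZ Q x' y' + bilZ Q x' z' + bilZ Q y' z').
  move=> Px Py Pz; have := vonorm_le posQ (x' + y' + z').
  rewrite !parityD Px Py Pz !quadZD // bilZDl.
  by congr (_ <= _); ring.
have b1 := bound x y z erefl erefl erefl.
have b2 := bound x (- y) z erefl (parityN _) erefl.
have b3 := bound x y (- z) erefl erefl (parityN _).
have b4 := bound x (- y) (- z) erefl (parityN _) (parityN _).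
have v3 := vonormD3 a b c.
rewrite -Exy in v3.
rewrite -Exz in v3.
rewrite -Eyz in v3.
rewrite v3 in b1 b2 b3 b4.
rewrite quadZN bilZNr in b2.
rewrite bilZNl in b2.
rewrite quadZN !bilZNr in b3.
rewrite !quadZN !bilZNr bilZNl opprK in b4.
rewrite -Exy normr_gt0 in pxy; rewrite -Exz normr_gt0 in pxz.
rewrite -Eyz normr_gt0 in pyz.
rewrite -[vonorm Q a]Hx -[vonorm Q b]Hy -[vonorm Q c]Hz in b1 b2 b3 b4.
apply: (norm_triple_sign pxy pxz pyz m3 (a := quadZ Q x) (b := quadZ Q y) (c := quadZ Q z));
  rewrite ?(mul1r, mulN1r, mulrN1, opprK, mulr1, mulrN); assumption.
Qed.

End ShortestVectors.

(** The signs are chosen in the order of increasing [n]: all earlier indices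
    that interact with [k] force the same sign on [k]. *)
Lemma sign_choice (R : realFieldType) (T : finType) (n : T -> nat) (b : T -> T -> R) :
  (forall i j, b i j = b j i) ->
  (forall i j k, i != j -> i != k -> j != k -> (n i <= n k)%N -> (n j <= n k)%N ->
     b i k != 0 -> b j k != 0 -> 0 < b i j * b i k * b j k) ->
  exists eps : T -> bool, forall i j, i != j ->
    0 <= (-1) ^+ (eps i) * (-1) ^+ (eps j) * b i j.
Proof.
move=> bC H; pose ord := relpre n leq.
have : pairwise ord (sort ord (enum T)).
  rewrite -sorted_pairwise; first by apply: sort_sorted => i j; apply: leq_total.
  by move=> i j k; apply: leq_trans.
suff IH s : pairwise ord s -> exists eps : T -> bool, forall i j, i \in s -> j \in s ->
    i != j -> 0 <= (-1) ^+ (eps i) * (-1) ^+ (eps j) * b i j.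
  move=> /IH[eps Heps]; exists eps => i j; apply: Heps;
  by rewrite mem_sort mem_enum.
elim/last_ind: s => [|s k IHs]; first by exists (fun=> false).
rewrite pairwise_rcons => /andP[/allP lek /IHs[eps Heps]].
pose ext c i := if i == k then c else eps i.
have ext_ok (c : bool) : (forall i, i \in s -> i != k -> 0 <= (-1) ^+ (eps i) * (-1) ^+ c * b i k) ->
    exists eps : T -> bool, forall i j, i \in rcons s k -> j \in rcons s k ->
      i != j -> 0 <= (-1) ^+ (eps i) * (-1) ^+ (eps j) * b i j.
  move=> Hc; exists (ext c) => i j; rewrite !mem_rcons !in_cons /ext.
  case: (eqVneq i k) => [->|ik]; case: (eqVneq j k) => [->|jk] //=; rewrite ?eqxx //.
  - by move=> _ js _; rewrite [X in X * _]mulrC bC; apply: Hc.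
  - by move=> si _ _; apply: Hc.
  exact: Heps.
have [/existsP[i0 /and3P[i0s i0k bi0]]|/existsPn no] :=
    boolP [exists i, [&& i \in s, i != k & b i k != 0]]; last first.
  apply: (ext_ok false) => i si ik; have := no i; rewrite si ik /= negbK => /eqP ->.
  by rewrite mulr0.
have sgn2 (c : bool) : (-1) ^+ c * (-1) ^+ c = 1 :> R by rewrite -signr_addb addbb.
have [c Hc] : exists c : bool, 0 < (-1) ^+ (eps i0) * (-1) ^+ c * b i0 k.
  exists (eps i0 (+) (b i0 k < 0)).
  rewrite signr_addb mulrA sgn2 mul1r; case: (ltrP (b i0 k) 0) => h.
    by rewrite expr1 mulN1r oppr_gt0.
  by rewrite expr0 mul1r lt_neqAle eq_sym bi0.
apply: (ext_ok c) => i si ik.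
have [->|bik] := eqVneq (b i k) 0; first by rewrite mulr0.
have [->|ii0] := eqVneq i i0; first exact: ltW.
have P := H i i0 k ii0 ik i0k (lek i si) (lek i0 i0s) bik bi0.
have E := Heps i i0 si i0s ii0.
set u := (-1) ^+ eps i in E *; set v := (-1) ^+ eps i0 in E Hc *; set w := (-1) ^+ c in Hc *.
have vv : v * v = 1 := sgn2 _; have uu : u * u = 1 := sgn2 _; have ww : w * w = 1 := sgn2 _.
have id : (u * v * b i i0) * (v * w * b i0 k) * (u * w * b i k) =
    (u * u) * (v * v) * (w * w) * (b i i0 * b i k * b i0 k) by ring.
rewrite uu vv ww !mul1r in id; rewrite -id in P.
rewrite leNgt; apply/negP => neg.
have := mulr_ge0 E (ltW Hc); rewrite le_eqVlt => /orP[/eqP z|pos].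
  by rewrite -z mul0r ltxx in P.
by have := lt_trans P (_ : _ < 0); rewrite ltxx => /(_ (ltac:(by rewrite pmulr_rlt0))).
Qed.

(** * Integral chains and cuts of a graph *)

Lemma ffunMzE (T : finType) (h : {ffun T -> int}) (k : int) x : (h *~ k) x = h x *~ k.
Proof. by case: k => n; rewrite ?NegzE ?mulrNz ?ffunE -!pmulrn ffunMnE. Qed.

Section Chains.
Variable G : graph.
Implicit Types (z y : {ffun edge G -> int}) (f : edge G) (u v w : vert G).
Implicit Types (S : {set vert G}) (T X : {set edge G}).

Definition cut S : {set edge G} := [set f | (src f \in S) != (tgt f \in S)].

Lemma boundaryD y z : boundary (y + z) = boundary y + boundary z.
Proof.
apply/ffunP => v; rewrite !ffunE.
under eq_bigr do rewrite ffunE.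
under [X in _ - X]eq_bigr do rewrite ffunE.
by rewrite !big_split /=; ring.
Qed.

Lemma boundaryN z : boundary (- z) = - boundary z.
Proof.
apply/ffunP => v; rewrite !ffunE.
under eq_bigr do rewrite ffunE.
under [X in _ - X]eq_bigr do rewrite ffunE.
by rewrite !sumrN; ring.
Qed.

Lemma boundary0 : boundary (0 : {ffun edge G -> int}) = 0.
Proof. by apply: (addrI (boundary 0)); rewrite -boundaryD !addr0. Qed.

Lemma boundary_sum (I : Type) (s : seq I) (P : pred I) (F : I -> {ffun edge G -> int}) :
  boundary (\sum_(i <- s | P i) F i) = \sum_(i <- s | P i) boundary (F i).
Proof.
elim: s => [|i s IH]; first by rewrite !big_nil boundary0.
by rewrite !big_cons; case: (P i); rewrite ?boundaryD IH.
Qed.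

Lemma boundaryMz z (k : int) : boundary (z *~ k) = boundary z *~ k.
Proof.
have nat_case z' n : boundary (z' *+ n) = boundary z' *+ n.
  by elim: n => [|n IHn]; rewrite ?boundary0 // !mulrS boundaryD IHn.
by case: k => n; rewrite ?NegzE ?mulrNz ?boundaryN -!pmulrn nat_case.
Qed.

Lemma boundary_cut z S :
  \sum_(v in S) boundary z v = \sum_(f | tgt f \in S) z f - \sum_(f | src f \in S) z f.
Proof.
under eq_bigr do rewrite ffunE.
rewrite sumrB; congr (_ - _).
  rewrite (partition_big (@tgt G) (fun v => v \in S)) //=.
  apply: eq_bigr => v vS; apply: eq_bigl => f.
  by case: eqP => [->|_]; rewrite ?vS ?andbF.
rewrite (partition_big (@src G) (fun v => v \in S)) //=.
apply: eq_bigr => v vS; apply: eq_bigl => f.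
by case: eqP => [->|_]; rewrite ?vS ?andbF.
Qed.

Lemma cycle_cut z S : boundary z = 0 ->
  \sum_(f in cut S) z f *~ (if tgt f \in S then 1 else -1) = 0.
Proof.
move=> z0; have := boundary_cut z S.
rewrite big1 => [|v _]; last by rewrite z0 ffunE.
move=> /esym; rewrite big_mkcond [X in _ - X]big_mkcond [in X in _ -> X]big_mkcond /= -sumrB.
move=> E; rewrite -[RHS]E; apply: eq_bigr => f _; rewrite inE.
by case: (src f \in S); case: (tgt f \in S) => //=; rewrite ?subrr ?subr0 ?sub0r ?mulr1z ?mulrNz ?mulr1z.
Qed.

Definition edge1 f : {ffun edge G -> int} := [ffun f' => (f' == f)%:Z].
Definition vert1 v : {ffun vert G -> int} := [ffun v' => (v' == v)%:Z].

Lemma boundary_edge1 f : boundary (edge1 f) = vert1 (tgt f) - vert1 (src f).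
Proof.
apply/ffunP => v; rewrite !ffunE.
have one (h : edge G -> vert G) : \sum_(f' | h f' == v) edge1 f f' = (v == h f)%:Z.
  rewrite big_mkcond (bigD1 f) //= big1 ?addr0 => [|f' ff'].
    by rewrite ffunE eqxx eq_sym; case: eqP.
  by rewrite ffunE (negPf ff') if_same.
by rewrite !one.
Qed.

Lemma connect_chain X u v : connect (adj X) u v ->
  exists2 y, boundary y = vert1 v - vert1 u & forall f, f \notin X -> y f = 0.
Proof.
move=> /connectP[p]; elim: p u => [|w p IH] u /=.
  by move=> _ ->; exists 0; rewrite ?boundary0 ?subrr // => f _; rewrite ffunE.
move=> /andP[/existsP[f /andP[fX Hf]] /IH{}IH /IH[y By y0]].
have off f' : f' \notin X -> edge1 f f' = 0.
  by move=> f'X; rewrite ffunE; case: eqP f'X => // ->; rewrite fX.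
case/orP: Hf => /andP[/eqP Ef1 /eqP Ef2].
  exists (edge1 f + y); first by rewrite boundaryD By boundary_edge1 Ef1 Ef2 addrC addrA subrK.
  by move=> f' f'X; rewrite ffunE off // y0.
exists (- edge1 f + y); first by rewrite boundaryD boundaryN By boundary_edge1 Ef1 Ef2 opprB addrC addrA subrK.
by move=> f' f'X; rewrite ffunE ffunE off // y0.
Qed.

Lemma adj_sym X : symmetric (adj X).
Proof. by move=> u v; apply: eq_existsb => f; rewrite orbC. Qed.

Lemma connect_adj_sym X : connect_sym (adj X).
Proof. by apply: sym_connect_sym; apply: adj_sym. Qed.

Lemma adj_edge X f : f \in X -> adj X (src f) (tgt f).
Proof. by move=> fX; apply/existsP; exists f; rewrite fX !eqxx. Qed.

Lemma cut_component X u : [disjoint X & cut [set v | connect (adj X) u v]].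
Proof.
rewrite disjoint_subset; apply/subsetP => f fX; rewrite !inE negbK.
have a := adj_edge fX.
apply/eqP; apply/idP/idP => h; apply: connect_trans h (connect1 _) => //.
by rewrite adj_sym.
Qed.

Lemma cut_disjointP X S : [disjoint X & cut S] ->
  forall u v, connect (adj X) u v -> (u \in S) = (v \in S).
Proof.
move=> dis u v /connectP[p]; elim: p u => [|w p IH] u /=; first by move=> _ ->.
move=> /andP[/existsP[f /andP[fX Hf]] /IH{}IH /IH <-].
have := disjointFr dis fX; rewrite inE => /negbFE/eqP.
by case/orP: Hf => /andP[/eqP -> /eqP ->].
Qed.

(** A bridge is the only edge of a cut, so no flow can cross it. *)
Lemma bridge_cycle f z : bridge f -> boundary z = 0 -> z f = 0.
Proof.
move=> br z0; set X := [set~ f].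
pose S := [set v | connect (adj X) (src f) v].
have cutS : cut S = [set f].
  apply/setP => f'; rewrite in_set1 inE.
  have [->|f'f] := eqVneq f' f; first by rewrite !inE connect0 (negPf br).
  have := disjointFr (cut_component X (src f)) (_ : f' \in X).
  by rewrite !inE => /(_ f'f) ->.
have := cycle_cut S z0; rewrite cutS big_set1; case: ifP => _.
  by rewrite mulr1z.
by rewrite mulrNz mulr1z => /eqP; rewrite oppr_eq0 => /eqP.
Qed.

Lemma nonbridge_cycle f : ~~ bridge f -> exists2 z, boundary z = 0 & z f = 1.
Proof.
rewrite negbK => /connect_chain[y By yf].
exists (edge1 f - y); first by rewrite boundaryD boundaryN By boundary_edge1 subrr.
by rewrite !ffunE eqxx yf ?subr0 // !inE eqxx.
Qed.

End Chains.

Section Flows.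
Variable G : graph.
Implicit Types (z y : {ffun edge G -> int}) (f e : edge G) (u v w : vert G).
Implicit Types (S : {set vert G}) (T X : {set edge G}).

(** Follow the flow [z] from [f] on.  If it never returned to the tail of [f], then
    the set of vertices reached would have an inflow through [f] but no
    outflow. *)
Lemma conformal_cycle z f : boundary z = 0 -> z f != 0 ->
  exists C : {ffun edge G -> int}, [/\ boundary C = 0, C f != 0 &
    forall e, C e = 0 \/ (z e != 0 /\ C e = sgz (z e))].
Proof.
move=> z0 zf; pose hd e := dart_head (e, 0 < z e); pose tl e := dart_tail (e, 0 < z e).
pose nx : rel (edge G) := fun e e' => (z e' != 0) && (hd e == tl e').
pose S := [set v | [exists e, connect nx f e && (hd e == v)]].
have hdS e : connect nx f e -> hd e \in S.
  by move=> c; rewrite inE; apply/existsP; exists e; rewrite c eqxx.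
have step e : z e != 0 -> tl e \in S -> hd e \in S.
  rewrite inE => ze /existsP[e' /andP[c /eqP E]]; apply: hdS.
  by apply: connect_trans c (connect1 _); rewrite /nx ze E eqxx.
have [g [cg hg]] : exists g, connect nx f g /\ hd g = tl f.
  have [|tlS] := boolP (tl f \in S).
    by rewrite inE => /existsP[g /andP[c /eqP E]]; exists g.
  have hS := hdS f (connect0 _ _).
  have := cycle_cut S z0.
  have fcut : f \in cut S.
    rewrite inE; move: hS tlS; rewrite /hd /tl /dart_head /dart_tail /=.
    by case: ifP => _ -> /negPf ->.
  have term e : e \in cut S -> z e *~ (if tgt e \in S then 1 else -1) = `|z e|.
    rewrite inE; have [->|ze] := eqVneq (z e) 0; first by rewrite mul0rz normr0.
    have := step e ze; rewrite /hd /tl /dart_head /dart_tail /=.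
    case: (ltrP 0 (z e)) => s; case: (src e \in S) => //=; case: (tgt e \in S) => //=.
    - by move=> /(_ isT).
    - by move=> _ _; rewrite mulr1z gtr0_norm.
    - by move=> _ _; rewrite mulrNz mulr1z ler0_norm.
    - by move=> /(_ isT).
  rewrite (eq_bigr _ term) => E; exfalso.
  have : 0 < \sum_(e in cut S) `|z e|.
    by rewrite (bigD1 f) //=; apply: ltr_wpDr; rewrite ?sumr_ge0 // normr_gt0.
  by rewrite E ltxx.
have [p0 pth0 Eg0] := connectP cg.
move: Eg0; case: (shortenP pth0) => p pth uq _ Eg {pth0 p0}.
have zpos e : e \in f :: p -> z e != 0.
  rewrite in_cons => /orP[/eqP -> //|].
  elim: p f pth {uq Eg cg hg zf S hdS step} => [|e1 p IH] f' //= /andP[/andP[ze1 _] pth].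
  by rewrite in_cons => /orP[/eqP -> //|]; apply: (IH e1).
pose C : {ffun edge G -> int} := \sum_(e <- f :: p) (edge1 e *~ sgz (z e)).
have CE e : C e = (if e \in f :: p then sgz (z e) else 0).
  rewrite /C sum_ffunE.
  have ev e' : (edge1 e' *~ sgz (z e')) e = (if e' == e then sgz (z e) else 0).
    rewrite ffunMzE ffunE eq_sym; case: eqP => [->|_]; rewrite ?mul0rz //.
    by rewrite intz.
  under eq_bigr do rewrite ev.
  case: ifP => [ein|/negP eout].
    rewrite (bigD1_seq e) //= eqxx big1 ?addr0 // => e' /negPf ->; by [].
  rewrite big_seq big1 // => e' e'in; case: eqP => // E.
  by case: eout; rewrite -E.
exists C; split.
- have bd e : z e != 0 -> boundary (edge1 e *~ sgz (z e)) = vert1 (hd e) - vert1 (tl e).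
    move=> ze; rewrite boundaryMz boundary_edge1 /hd /tl /dart_head /dart_tail /=.
    case: (ltrP 0 (z e)) => s; first by rewrite gtr0_sgz // mulr1z.
    by rewrite ltr0_sgz ?mulrNz ?mulr1z ?opprB // lt_neqAle ze.
  rewrite boundary_sum; under eq_big_seq => e ein do rewrite bd ?zpos //.
  have tele : \sum_(e <- f :: p) (vert1 (hd e) - vert1 (tl e)) =
     vert1 (hd (last f p)) - vert1 (tl f).
    elim: p f pth {uq Eg cg hg zf S hdS step zpos C CE bd} => [|e1 p IH] f' /=.
      by rewrite big_seq1.
    move=> /andP[/andP[_ /eqP E] pth]; rewrite big_cons (IH e1 pth) E.
    by rewrite addrC addrA subrK.
  by rewrite tele -Eg hg subrr.
- by rewrite CE mem_head sgz_eq0.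
move=> e; rewrite CE; case: ifP => [ein|_]; last by left.
by right; split; first exact: zpos.
Qed.

(** Subtracting twice a conformal cycle through an edge with a coordinate outside of
    0, 1 and -1 brings the coordinates closer to zero. *)
Lemma unit_lift z : boundary z = 0 ->
  exists y, boundary y = 0 /\ forall f, `|(z - (y + y)) f| <= 1.
Proof.
have [n] := ubnP (\sum_e `|z e|)%N; elim: n z => // n IHn z lt_n z0.
have [/forallP H|/forallPn[f zf]] := boolP [forall f, `|z f| <= 1].
  by exists 0; split; [exact: boundary0|move=> f; rewrite addr0 subr0].
have zf0 : z f != 0 by apply: contraNneq zf => ->; rewrite normr0.
have [C [C0 Cf CE]] := conformal_cycle z0 zf0.
have [||y [y0 Hy]] := IHn (z - (C + C)).
- apply: leq_trans (_ : (\sum_e `|z e|)%N <= n)%N; last by rewrite -ltnS.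
  rewrite (bigD1 f) // [X in (_ <= X)%N](bigD1 f) //= -addSn; apply: leq_add.
    rewrite !ffunE; have [E|[_ ->]] := CE f; first by rewrite E eqxx in Cf.
    rewrite -ltNge in zf; move: (z f) zf0 zf => k; case: sgzP => hk; rewrite ?hk ?eqxx // => _; lia.
  apply: leq_sum => e _; rewrite !ffunE; have [->|[ze ->]] := CE e; first by rewrite ?addr0 ?subr0.
  by move: (z e) ze => k; case: sgzP => hk; rewrite ?hk ?eqxx // => _; lia.
- by rewrite boundaryD boundaryN boundaryD z0 C0 addr0 subr0.
exists (C + y); split; first by rewrite boundaryD C0 y0 addr0.
move=> e; have := Hy e; congr (`| _ | <= _); rewrite !ffunE; lia.
Qed.

Lemma cut_even z S : boundary z = 0 -> exists k, \sum_(f in cut S) z f = k + k.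
Proof.
move=> z0; exists (\sum_(f in cut S) (if tgt f \in S then 0 else z f)).
rewrite -[LHS]subr0 -[X in _ - X](cycle_cut S z0) -sumrB -big_split /=; apply: eq_bigr => f _.
by case: ifP; rewrite ?mulrNz mulr1z; lia.
Qed.

(** One side of the cut consists of the vertices reached from a base point by a
    chain with odd sum on [T]; the parity does not depend on the chain. *)
Lemma orthogonal_cut T : connected_graph G ->
  (forall z, boundary z = 0 -> exists k, \sum_(f in T) z f = k + k) ->
  exists S, T = cut S.
Proof.
move=> [/card_gt0P[v0 _] conn] even.
have /choice[y Hy] v : exists y : {ffun edge G -> int}, boundary y = vert1 v - vert1 v0.
  by have [y By _] := connect_chain (conn v0 v); exists y.
pose p v := odd (absz (\sum_(f in T) y v f)).
exists [set v | p v]; apply/setP => f; rewrite !inE.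
have [|k Ek] := even (y (src f) + edge1 f - y (tgt f)).
  rewrite !boundaryD boundaryN !Hy boundary_edge1.
  by apply/ffunP => v; rewrite !ffunE; ring.
have := Ek.
under eq_bigr do rewrite !ffunE.
rewrite sumrB big_split /=.
have -> : \sum_(f' in T) (f' == f)%:Z = (f \in T)%:Z.
  case: (boolP (f \in T)) => fT.
    by rewrite (bigD1 f) //= eqxx big1 ?addr0 // => f' /andP[_ /negPf ->].
  by rewrite big1 // => f' f'T; case: eqP => // E; rewrite -E f'T in fT.
have par (a b c : int) (t : bool) : a + t%:Z - b = c + c -> t = (odd `|a| != odd `|b|).
  by case: t; lia.
exact: par.
Qed.

End Flows.

(** * Cographic and binary matroids *)

Section CographicMatroid.
Variable G : graph.
Implicit Types (f e : edge G) (u v w : vert G) (d : edge G * bool).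
Implicit Types (S : {set vert G}) (T X B : {set edge G}).

Let follows : rel (edge G * bool) := fun d d' => dart_head d == dart_tail d'.

Lemma adj_dart B d : d.1 \in B -> adj B (dart_tail d) (dart_head d).
Proof.
move=> dB; apply/existsP; exists d.1; rewrite dB /dart_tail /dart_head.
by case: d.2; rewrite !eqxx ?orbT.
Qed.

Lemma cycle_connect (s : seq (edge G * bool)) f B : graph_cycle s ->
  f \in [seq d.1 | d <- s] -> {subset [seq d.1 | d <- s] <= f |: B} ->
  connect (adj B) (src f) (tgt f).
Proof.
move=> [_ cyc _ uq] /mapP[d ds fd] sub.
have [i s' Es] := rot_to ds.
have cyc' : cycle follows (d :: s') by rewrite -Es rot_cycle.
have uq' : uniq [seq d.1 | d <- d :: s'] by rewrite -Es map_rot rot_uniq.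
have sub' d' : d' \in s' -> d'.1 \in B.
  move=> d's; have : d'.1 \in f |: B.
    by apply: sub; apply: map_f; rewrite -(mem_rot i) Es in_cons d's orbT.
  rewrite in_setU1 => /orP[/eqP E|//]; move: uq' => /= /andP[/negP[]].
  by rewrite -fd -E; apply: map_f.
have walk s0 d0 : path follows d0 (rcons s0 d) -> {subset s0 <= s'} ->
    connect (adj B) (dart_head d0) (dart_tail d).
  elim: s0 d0 => [|d1 s0 IH] d0 /=; first by rewrite andbT => /eqP -> _; apply: connect0.
  move=> /andP[/eqP -> pth] sb; apply: connect_trans (IH d1 pth _).
    by apply/connect1/adj_dart/sub'/sb/mem_head.
  by move=> x xs; apply: sb; rewrite in_cons xs orbT.
have := walk s' d cyc' (fun x xs => xs); rewrite fd /dart_head /dart_tail.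
by case: d.2 => //; rewrite (connect_adj_sym B (tgt _)).
Qed.

(** Passing to darts keeps the edges distinct because the path does not return to a
    vertex, so that no edge is traversed in both directions. *)
Lemma path_darts B u p : path (adj B) u p -> uniq (u :: p) ->
  exists q : seq (edge G * bool), [/\ all (fun d => d.1 \in B) q,
    [seq dart_tail d | d <- q] = belast u p, [seq dart_head d | d <- q] = p,
    uniq [seq d.1 | d <- q] &
    forall d, dart_head d = u -> path follows d q /\ dart_head (last d q) = last u p].
Proof.
elim: p u => [|v p IH] u; first by move=> _ _; exists [::].
move=> /=/andP[/existsP[f /andP[fB Hf]] pth] /andP[unin uq].
have [q [qB qt qh quq qf]] := IH v pth uq.
have [b [tb hb]] : exists b, dart_tail (f, b) = u /\ dart_head (f, b) = v.
  by case/orP: Hf => /andP[/eqP h1 /eqP h2]; [exists true|exists false]; split.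
exists ((f, b) :: q); split => /=.
- by rewrite fB.
- by rewrite tb qt.
- by rewrite hb qh.
- rewrite quq andbT; apply/mapP => -[d dq fd].
  have td : dart_tail d \in v :: p.
    by apply: mem_belast; rewrite -qt; apply: map_f.
  have hd : dart_head d \in v :: p.
    by rewrite in_cons -qh; apply/orP; right; apply: map_f.
  move: td hd; rewrite /dart_tail /dart_head -fd.
  move: tb; rewrite /dart_tail /=.
  by case: b {hb} => /= ->; case: d.2; rewrite (negPf unin).
move=> d hd; have [p1 p2] := qf (f, b) hb.
by rewrite p1 p2 andbT /follows hd tb eqxx.
Qed.

Lemma connect_cyclic B f : f \notin B -> connect (adj B) (src f) (tgt f) ->
  ~ acyclic (f |: B).
Proof.
rewrite connect_adj_sym => fB /connectP[p0 pth0 E0].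
move: E0; case: (shortenP pth0) => p pth uq _ E {pth0 p0}.
have [q [qB qt qh quq qf]] := path_darts pth uq.
have [p1 p2] := qf (f, true) erefl.
have gc : graph_cycle ((f, true) :: q).
  split=> //=.
  - by rewrite rcons_path p1 p2 -E /dart_tail eqxx.
  - by rewrite qt; move: uq; rewrite lastI rcons_uniq -E.
  - rewrite quq andbT; apply/mapP => -[d dq /= fd]; move/allP: qB => /(_ d dq).
    by rewrite -fd (negPf fB).
move=> /(_ _ gc)/negP[]; rewrite /= setU11; apply/allP => d dq.
by rewrite in_setU1 (allP qB d dq) orbT.
Qed.

Lemma not_acyclic_connect B f : acyclic B -> ~ acyclic (f |: B) ->
  connect (adj B) (src f) (tgt f).
Proof.
move=> aB naf; have [s cs] : exists2 s, graph_cycle s & all (fun d => d.1 \in f |: B) s.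
  apply: contrapT => H; apply: naf => s cs; apply/negP => a; apply: H.
  by exists s.
move=> /allP sub; apply: (cycle_connect cs); last first.
  by move=> _ /mapP[d ds ->]; apply: sub.
apply/negPn/negP => fs; have /negP[] := aB s cs.
apply/allP => d ds; have := sub d ds; rewrite in_setU1 => /orP[/eqP E|//].
by case/negP: fs; rewrite -E; apply: map_f.
Qed.

Lemma acyclicS B B' : B \subset B' -> acyclic B' -> acyclic B.
Proof.
move=> /subsetP sub aB' s cs; apply: contra (aB' s cs).
by apply: sub_all => d; apply: sub.
Qed.

(** If [T] contains no cut, then removing [T] does not separate any component, and a
    maximal forest outside of [T] is a basis.  Conversely an edge of a cut inside
    of [T] could be added to a forest outside of [T]. *)
Lemma dual_graphic_indepP T : @indep (dual_indsys (graphic_matroid G)) T <->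
  forall S, cut S \subset T -> cut S = set0.
Proof.
split=> [[B [aB maxB] dTB] S sST|noT].
  apply/eqP/set0Pn => -[f fS].
  have fB : f \notin B by rewrite (disjointFr dTB) // (subsetP sST).
  have /(not_acyclic_connect aB) : ~ acyclic (f |: B).
    move=> /maxB/(_ (subsetUr _ _)) E.
    by move: fB; rewrite -E setU11.
  have disB : [disjoint B & cut S] by rewrite disjoint_sym; apply: disjointWl dTB.
  move=> /(cut_disjointP disB) E; move: fS.
  by rewrite inE E eqxx.
pose P A := `[< acyclic A >] && (A \subset ~: T).
have [|B /maxsetP[/andP[/asboolP aB sB] maxB]] := @ex_maxset _ P.
  exists set0; rewrite /P sub0set andbT; apply/asboolP => -[|d s] [] // _ _ _ _.
  by rewrite /= in_set0.
have extB f : f \notin T -> acyclic (f |: B) -> f \in B.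
  move=> fT afB; rewrite -(maxB (f |: B)) ?setU11 ?subsetUr // /P; apply/andP; split.
    by apply/asboolP.
  by rewrite subUset sB sub1set inE fT.
have conn f : f \notin T -> connect (adj B) (src f) (tgt f).
  move=> fT; have [fB|fB] := boolP (f \in B); first by apply/connect1/adj_edge.
  by apply: not_acyclic_connect => // /(extB f fT); rewrite (negPf fB).
exists B; last by rewrite disjoint_sym disjoints_subset.
split=> // B' aB' sBB'; apply/eqP; rewrite eqEsubset sBB' andbT.
apply/subsetP => f fB'; apply/negPn/negP => fB.
have afB : acyclic (f |: B).
  by apply: acyclicS aB'; rewrite subUset sub1set fB'.
have fT : f \in T by apply: contraR fB => /extB; apply.
apply: (connect_cyclic fB) afB.
pose S := [set v | connect (adj (~: T)) (src f) v].
have dS := cut_component (~: T) (src f); rewrite -/S in dS.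
have /noT cS0 : cut S \subset T by rewrite disjoint_sym disjoints_subset setCK in dS.
have : tgt f \in S.
  have : f \notin cut S by rewrite cS0 in_set0.
  by rewrite inE negbK inE connect0 => /eqP <-.
rewrite inE; apply: connect_sub => u v /existsP[e /andP[]]; rewrite inE => /conn eT.
by case/orP => /andP[/eqP <- /eqP <-] //; rewrite connect_adj_sym.
Qed.

Lemma cut_symdiff S S' : cut ((S :\: S') :|: (S' :\: S)) = (cut S :\: cut S') :|: (cut S' :\: cut S).
Proof.
apply/setP => f; rewrite !(inE, in_setU, in_setD).
by case: (src f \in S); case: (src f \in S'); case: (tgt f \in S); case: (tgt f \in S').
Qed.

End CographicMatroid.

(** Every nonempty member contains a minimal one, which is also minimal in the other
    family; removing it is a symmetric difference, and induction applies. *)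
Lemma eq_symdiff_families (T : finType) (F1 F2 : {set T} -> Prop) :
  F1 set0 -> F2 set0 ->
  (forall A B : {set T}, F1 A -> F1 B -> F1 ((A :\: B) :|: (B :\: A))) ->
  (forall A B : {set T}, F2 A -> F2 B -> F2 ((A :\: B) :|: (B :\: A))) ->
  (forall A : {set T}, (forall B, F1 B -> B \subset A -> B = set0) <->
             (forall B, F2 B -> B \subset A -> B = set0)) ->
  forall A, F1 A <-> F2 A.
Proof.
suff one_side (F F' : {set T} -> Prop) : F' set0 ->
  (forall A B : {set T}, F A -> F B -> F ((A :\: B) :|: (B :\: A))) ->
  (forall A B : {set T}, F' A -> F' B -> F' ((A :\: B) :|: (B :\: A))) ->
  (forall A : {set T}, (forall B, F B -> B \subset A -> B = set0) <->
             (forall B, F' B -> B \subset A -> B = set0)) ->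
  forall A, F A -> F' A.
  move=> z1 z2 c1 c2 H A; split; first exact: one_side.
  by apply: one_side => // B; have [] := H B.
move=> z' c c' H A; have [n] := ubnP #|A|; elim: n A => // n IHn A lt_n FA.
have [->//|A0] := eqVneq A set0.
have sub (K1 K2 : {set T} -> Prop) (B : {set T}) : (forall A : {set T}, (forall B, K1 B -> B \subset A -> B = set0) <->
             (forall B, K2 B -> B \subset A -> B = set0)) ->
    K1 B -> B != set0 -> exists B', [/\ K2 B', B' \subset B & B' != set0].
  move=> H12 F1B B0; apply: contrapT => no; case/eqP: B0.
  apply: (H12 B).2 => // B' F2B' sB'; apply/eqP/negPn/negP => B'0; apply: no.
  by exists B'.
pose P B := `[< F B >] && (B != set0).
have [|B /minsetP[/andP[/asboolP FB B0] minB] sBA] := @minset_exists _ P A.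
  by apply/andP; split; first exact/asboolP.
have [B' [F'B' sB'B B'0]] := sub F F' B H FB B0.
have [B'' [FB'' sB''B' B''0]] := sub F' F B' (fun A => iff_sym (H A)) F'B' B'0.
have E : B'' = B.
  apply: minB; last exact: subset_trans sB'B.
  by apply/andP; split; first exact/asboolP.
have EB : B' = B by apply/eqP; rewrite eqEsubset sB'B -E.
rewrite EB in F'B'.
have AB : A :\: B :|: B :\: A = A :\: B.
  by move: sBA; rewrite -setD_eq0 => /eqP ->; rewrite setU0.
have FAB : F (A :\: B) by rewrite -AB; apply: c.
have F'AB : F' (A :\: B).
  apply: IHn FAB; rewrite -ltnS; apply: leq_trans lt_n; rewrite ltnS.
  apply: proper_card; rewrite properEneq subsetDl andbT.
  apply: contra_neq B0 => E2; apply/eqP; rewrite -subset0; apply/subsetP => x xB.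
  by have := subsetP sBA x xB; rewrite -E2 inE xB.
have -> : A = ((A :\: B) :\: B) :|: (B :\: (A :\: B)).
  apply/setP => x; rewrite !inE; case xB : (x \in B) => //=; last by rewrite ?andbF ?orbF.
  by rewrite (subsetP sBA x xB).
exact: c'.
Qed.

Section BinaryMatroid.
Variables (g : nat) (E : {set 'rV['F_2]_g}).

(** A linear dependency over the field with two elements is a set with zero sum. *)
Lemma free_F2P (S : {set {e : 'rV['F_2]_g | e \in E}}) :
  free [seq val e | e in S] <->
  forall T : {set {e : 'rV['F_2]_g | e \in E}}, \sum_(e in T) val e = 0 -> T \subset S -> T = set0.
Proof.
set X := [seq val e | e in S].
have sz : size X = size (enum S) by rewrite size_map.
have sumE (c : {e : 'rV['F_2]_g | e \in E} -> 'F_2) (k : 'I_(size X) -> 'F_2) :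
   (forall i (x0 : {e : 'rV['F_2]_g | e \in E}), k i = c (nth x0 (enum S) i)) ->
   \sum_i k i *: (in_tuple X)`_i = \sum_(e in S) c e *: val e.
  move=> Hk; rewrite -[RHS]big_enum /=.
  case ES : (enum S) => [|x0 s].
    rewrite big_nil; apply: big1 => i _.
    by have := ltn_ord i; rewrite {2}sz ES.
  rewrite -ES (big_nth x0) big_mkord -sz; apply: eq_bigr => i _.
  by rewrite (Hk i x0) /= /X (nth_map x0) // -sz.
split=> [/(@freeP _ _ _ (in_tuple X)) H T T0 sTS|H].
  apply/eqP/set0Pn => -[e eT]; pose c x : 'F_2 := (x \in T)%:R.
  have eS := subsetP sTS e eT.
  pose k (i : 'I_(size X)) := c (nth e (enum S) i).
  have le : (index e (enum S) < size X)%N by rewrite sz index_mem mem_enum.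
  have := H k _ (Ordinal le); rewrite /k /= nth_index ?mem_enum // /c eT.
  move=> /(_ _)/eqP; rewrite oner_eq0 => /(_ _)/negP []//.
  rewrite (sumE c) => [|i x0]; last first.
    by rewrite /k /= (set_nth_default x0) // -sz.
  rewrite -[RHS]T0 big_mkcond [RHS]big_mkcond; apply: eq_bigr => x _.
  have := subsetP sTS x; rewrite /c; case: (x \in T); case: (x \in S); rewrite ?scale1r ?scale0r //.
  by move=> /(_ isT).
apply/(@freeP _ _ _ (in_tuple X)) => k k0 i.
have [x0 _] : exists x0, x0 \in enum S.
  have := ltn_ord i; rewrite {2}sz; case: (enum S) => // x0 s _; exists x0; exact: mem_head.
pose c x : 'F_2 := if insub (index x (enum S)) is Some j then k j else 0.
have kc j x1 : k j = c (nth x1 (enum S) j).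
  rewrite /c index_uniq ?enum_uniq -?sz //.
  by case: insubP => [j' _ /val_inj ->//|]; rewrite ltn_ord.
rewrite (sumE c k kc) in k0.
have E0 : [set x in S | c x != 0] = set0.
  apply: H; last by apply/subsetP => x; rewrite inE => /andP[].
  transitivity (\sum_(e in S) c e *: val e); last exact: k0.
  rewrite [LHS]big_mkcond [RHS]big_mkcond; apply: eq_bigr => x _; rewrite inE.
  case: (x \in S) => //=; rewrite F2_neq0 {2}(F2_eqb (c x)).
  by case: (c x == 1); rewrite ?scale1r ?scale0r.
apply/eqP/negPn/negP; rewrite (kc i x0) => nz.
have : nth x0 (enum S) i \in [set x in S | c x != 0].
  by rewrite inE nz andbT -mem_enum mem_nth // -sz.
by rewrite E0 in_set0.
Qed.

Lemma sum_symdiff (I : finType) (F : I -> 'rV['F_2]_g) (A B : {set I}) :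
  \sum_(e in (A :\: B) :|: (B :\: A)) F e = \sum_(e in A) F e + \sum_(e in B) F e.
Proof.
rewrite [LHS]big_mkcond [X in X + _]big_mkcond [X in _ + X]big_mkcond -big_split /=.
apply: eq_bigr => e _; rewrite !inE.
by case: (e \in A); case: (e \in B); rewrite /= ?addr0 ?add0r ?matrix_F2_addxx.
Qed.

End BinaryMatroid.

(** Both matroids have as independent sets those that contain no nonempty member of
    a family closed under symmetric difference: the sets with zero sum, and the
    cuts.  Isomorphisms of the matroids are bijections that identify the families
    ([eq_symdiff_families]). *)
Lemma cographicP (g : nat) (E : {set 'rV['F_2]_g}) :
  cographic (binary_matroid E) <->
  exists (G : graph) (h : {e : 'rV['F_2]_g | e \in E} -> edge G), bijective h /\
    forall T : {set {e : 'rV['F_2]_g | e \in E}},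
      \sum_(e in T) val e = 0 <-> exists S, h @: T = cut S.
Proof.
have key (G : graph) (h : {e : 'rV['F_2]_g | e \in E} -> edge G) : bijective h ->
  (forall T : {set {e : 'rV['F_2]_g | e \in E}}, free [seq val e | e in T] <-> indep (i := dual_indsys (graphic_matroid G)) (h @: T)) <->
  forall T : {set {e : 'rV['F_2]_g | e \in E}},
      \sum_(e in T) val e = 0 <-> exists S, h @: T = cut S.
  move=> bh; have [h' hK h'K] := bh; have injh := bij_inj bh.
  have hTK (S : {set edge G}) : h @: (h @^-1: S) = S.
    apply/setP => f; apply/imsetP/idP => [[e]|fS].
      by rewrite inE => ? ->.
    by exists (h' f); rewrite ?inE h'K.
  have noP (T : {set {e : 'rV['F_2]_g | e \in E}}) :
     indep (i := dual_indsys (graphic_matroid G)) (h @: T) <->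
     (forall B : {set {e : 'rV['F_2]_g | e \in E}}, (exists S, h @: B = cut S) -> B \subset T -> B = set0).
    rewrite dual_graphic_indepP; split=> H.
      move=> B [S ES] sBT; have := H S; rewrite -ES => /(_ (imsetS _ sBT)) E0.
      by apply/eqP; rewrite -(imset_eq0 h) E0.
    move=> S sS; have sub : h @^-1: cut S \subset T.
      by apply/subsetP => e; rewrite inE => /(subsetP sS)/imsetP[e' e'T /injh ->].
    have E0 := H _ (ex_intro _ S (hTK _)) sub.
    by rewrite -(hTK (cut S)) E0 imset0.
  split=> H.
    apply: eq_symdiff_families.
    - by rewrite big_set0.
    - by exists set0; rewrite imset0; apply/setP => f; rewrite !inE.
    - by move=> A B sA sB; rewrite sum_symdiff sA sB addr0.
    - move=> A B [S ES] [S' ES'].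
      exists ((S :\: S') :|: (S' :\: S)); rewrite cut_symdiff -ES -ES'.
      by rewrite !(can2_imset_pre _ hK h'K) preimsetU !preimsetD.
    by move=> A; rewrite -free_F2P H noP.
  move=> T; rewrite free_F2P noP; split=> K B; first by rewrite -H; apply: K.
  by rewrite H; apply: K.
split=> [[G [h bh H]]|[G [h [bh H]]]]; exists G; exists h => //.
  by split=> //; apply/key.
by apply/key.
Qed.

(** * Normal spanning trees *)

Section JoinComponents.
Variable G : graph.

Let top_adj := adj [set: edge G].

Definition joined_vertex (o : option (vert G)) : bool :=
  if o is Some v then fingraph.root top_adj v != v else true.

Definition join_vertex (v : vert G) : option (vert G) :=
  if fingraph.root top_adj v == v then None else Some v.

Lemma join_vertexP v : joined_vertex (join_vertex v).
Proof. by rewrite /join_vertex; case: ifP => //= ->. Qed.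

(** One vertex of every component is glued to a common new vertex, which exists
    even if [G] is empty. *)
Definition joined : graph :=
  @Graph {o : option (vert G) | joined_vertex o} (edge G)
    (fun f => Sub (join_vertex (src f)) (join_vertexP _))
    (fun f => Sub (join_vertex (tgt f)) (join_vertexP _)).

Lemma joined_connected : connected_graph joined.
Proof.
pose o0 : vert joined := Sub None isT.
split; first by apply/card_gt0P; exists o0.
suff H o : connect (adj [set: edge joined]) o o0.
  move=> o o'; apply: connect_trans (H o) _.
  by rewrite connect_adj_sym; apply: H.
pose q v : vert joined := Sub (join_vertex v) (join_vertexP v).
have Hq u v : connect top_adj u v -> connect (adj [set: edge joined]) (q u) (q v).
  move=> /connectP[p]; elim: p u => [|w p IH] u /=; first by move=> _ ->; apply: connect0.
  move=> /andP[/existsP[f /andP[_ Hf]] pth] /(IH w pth); apply: connect_trans.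
  apply/connect1/existsP; exists f; rewrite in_setT.
  by case/orP: Hf => /andP[/eqP <- /eqP <-]; rewrite !eqxx ?orbT.
have symA := @connect_adj_sym G [set: edge G].
case: o => -[v|] Hv; last by apply: eq_connect0; apply: val_inj.
have -> : exist _ (Some v) Hv = q v.
  by apply: val_inj; rewrite /= /join_vertex (negPf Hv).
have <- : q (fingraph.root top_adj v) = o0.
  by apply: val_inj; rewrite /= /join_vertex fingraph.root_root // eqxx.
by apply: Hq; apply: connect_root.
Qed.

Lemma joined_cuts (T : {set edge G}) :
  (exists S : {set vert joined}, T = cut S) <-> (exists S : {set vert G}, T = cut S).
Proof.
have symA := @connect_adj_sym G [set: edge G].
split=> [[S ->]|[S ->]].
  exists [set v | Sub (join_vertex v) (join_vertexP v) \in S].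
  by apply/setP => f; rewrite !inE.
pose S1 v := (v \in S) != (fingraph.root top_adj v \in S).
exists [set o : vert joined | if val o is Some v then S1 v else false].
apply/setP => f; rewrite !inE /=.
have S1E v : (if join_vertex v is Some v0 then S1 v0 else false) = S1 v.
  by rewrite /join_vertex; case: eqP => // E; rewrite /S1 E eqxx.
rewrite !S1E /S1.
have -> : fingraph.root top_adj (src f) = fingraph.root top_adj (tgt f).
  by apply/fingraph.rootP => //; apply/connect1/adj_edge; rewrite in_setT.
by case: (src f \in S); case: (tgt f \in S); case: (fingraph.root _ _ \in S).
Qed.

End JoinComponents.

Section Ancestors.
Variables (V : finType) (r : V) (par : V -> V) (d : V -> nat).

Definition anc u v := fconnect par v u.

Lemma fconnect_step v u : fconnect par v u = (u == v) || fconnect par (par v) u.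
Proof.
apply/idP/idP => [/connectP[[|w p]] /=|/orP[/eqP ->|]].
- by move=> _ ->; rewrite eqxx.
- move=> /andP[/eqP <- pth] E; apply/orP; right; apply/connectP; by exists p.
- exact: connect0.
by apply: connect_trans; apply: fconnect1.
Qed.

Lemma anc_refl v : anc v v. Proof. exact: connect0. Qed.

Lemma anc_trans u v w : anc u v -> anc v w -> anc u w.
Proof. by move=> uv vw; apply: connect_trans uv. Qed.

Hypothesis dr : d r = 1%N.
Hypothesis parr : par r = r.
Hypothesis dS : forall v, v != r -> (0 < d v)%N ->
  (0 < d (par v))%N /\ d v = (d (par v)).+1.

Lemma anc_root v : anc v r -> v = r.
Proof.
move=> /connectP[p]; elim: p => [|w p IH] //=.
by rewrite parr => /andP[/eqP <-].
Qed.

Lemma anc_ind (P : V -> Prop) :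
  P r -> (forall v, v != r -> (0 < d v)%N -> P (par v) -> P v) ->
  forall v, (0 < d v)%N -> P v.
Proof.
move=> Pr Ps v; have [n] := ubnP (d v); elim: n v => // n IHn v lt_n dv.
have [->//|vr] := eqVneq v r.
have [dp E] := dS vr dv; apply: Ps => //; apply: IHn => //.
by move: lt_n; rewrite E.
Qed.

Lemma anc_step u v : anc u v = (u == v) || anc u (par v).
Proof. exact: fconnect_step. Qed.

Lemma root_anc v : (0 < d v)%N -> anc r v.
Proof.
by elim/anc_ind => [|w wr dw IH]; [exact: anc_refl|rewrite anc_step IH orbT].
Qed.

Lemma anc_depth u v : (0 < d v)%N -> anc u v -> (d u <= d v)%N /\ (0 < d u)%N.
Proof.
elim/anc_ind => [/anc_root -> //|w wr dw IH]; first by rewrite dr.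
rewrite anc_step => /orP[/eqP ->//|/IH[h1 h2]].
by split=> //; have [_ ->] := dS wr dw; apply: leqW.
Qed.

Lemma anc_comparable u w v : (0 < d v)%N -> anc u v -> anc w v -> (d u <= d w)%N -> anc u w.
Proof.
elim/anc_ind => [/anc_root -> /anc_root -> _|x xr dx IH]; first exact: anc_refl.
rewrite !(anc_step _ x) => /orP[/eqP ->|ux] /orP[/eqP ->|wx] le.
- exact: anc_refl.
- have [dp Ex] := dS xr dx; have [h _] := anc_depth dp wx.
  by move: (leq_trans le h); rewrite Ex ltnn.
- by rewrite anc_step ux orbT.
exact: IH.
Qed.

Lemma anc_eq u v : (0 < d v)%N -> anc u v -> d u = d v -> u = v.
Proof.
move=> dv uv E; have [vr|vr] := eqVneq v r; first by rewrite vr in uv *; apply: anc_root.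
move: uv; rewrite anc_step => /orP[/eqP //|up].
have [dp Ev] := dS vr dv; have [h _] := anc_depth dp up.
by move: h; rewrite E Ev ltnn.
Qed.

Lemma anc_level v k : (0 < d v)%N -> (0 < k <= d v)%N -> exists2 u, anc u v & d u = k.
Proof.
elim/anc_ind => [|w wr dw IH] /andP[k0 le].
  by exists r; [exact: anc_refl|rewrite dr; move: le k0; rewrite dr; case: k => [|[]]].
have [dp Ew] := dS wr dw; move: le; rewrite leq_eqVlt => /orP[/eqP ->|lt].
  by exists w => //; exact: anc_refl.
have [|u uw <-] := IH; first by rewrite k0 -ltnS -Ew.
by exists u; rewrite // anc_step uw orbT.
Qed.

Lemma depth_bound v : (d v <= #|V|)%N.
Proof.
have [->//|dv] := posnP (d v).
suff H : (d v <= #|[set u | anc u v]|)%N by apply: leq_trans H (max_card _).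
move: v dv; apply: anc_ind => [|v vr dv IH].
  by rewrite dr; apply/card_gt0P; exists r; rewrite inE anc_refl.
have [dp Ev] := dS vr dv.
have -> : [set u | anc u v] = v |: [set u | anc u (par v)].
  by apply/setP => u; rewrite !inE anc_step.
rewrite cardsU1 inE Ev; case: (boolP (anc v (par v))) => [a|_]; last by rewrite add1n ltnS.
by have [h _] := anc_depth dp a; rewrite Ev ltnn in h.
Qed.

End Ancestors.

Section NormalTree.
Variable G : graph.
Hypothesis connG : connected_graph G.
Let V := vert G.
Let touch := adj [set: edge G].

(** Vertices of depth zero lie outside of the tree; each is its own parent, so that it
    forms a branch of its own. *)
Definition partial_tree (r : V) (par : V -> V) (d : V -> nat) : Prop :=
  [/\ d r = 1%N, par r = r, (forall v, v != r -> d v = 0%N -> par v = v) &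
      forall v, v != r -> (0 < d v)%N ->
        [/\ (0 < d (par v))%N, d v = (d (par v)).+1 & touch (par v) v]].

(** If [u] is not above [v], hanging the branch at [u] below [v] deepens that
    branch.  This applies both to extending the tree to a new vertex [u] of
    depth zero and to an edge between two incomparable vertices. *)
Lemma rehang r par d u v : partial_tree r par d -> touch v u ->
  (0 < d v)%N -> (d u <= d v)%N -> ~~ anc par u v ->
  exists par' d', partial_tree r par' d' /\ (\sum_w d w < \sum_w d' w)%N.
Proof.
move=> [dr parr d0 dS] uv dv le nanc.
have dS' w (wr : w != r) (dw : (0 < d w)%N) : (0 < d (par w))%N /\ d w = (d (par w)).+1.
  by have [] := dS w wr dw.
have ur : u != r.
  by apply: contraNneq nanc => ->; apply: (root_anc dS').
pose k := ((d v).+1 - d u)%N.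
have kE : (d u + k = (d v).+1)%N by rewrite /k subnKC // ltnW.
pose par' w := if w == u then v else par w.
pose d' w := if anc par u w then (d w + k)%N else d w.
have step w : w != u -> anc par u w = anc par u (par w).
  by move=> wu; rewrite anc_step eq_sym (negPf wu).
have d'u : d' u = (d v).+1 by rewrite /d' anc_refl kE.
have d'v : d' v = d v by rewrite /d' (negPf nanc).
have le' w : (d w <= d' w)%N by rewrite /d'; case: ifP => // _; apply: leq_addr.
exists par', d'; split; last first.
  rewrite (bigD1 u) // [X in (_ < X)%N](bigD1 u) //= -addSn.
  by apply: leq_add; [rewrite d'u ltnS|apply: leq_sum].
split.
- rewrite /d' dr; case: ifP => // /(anc_root parr) E.
  by rewrite E eqxx in ur.
- by rewrite /par' eq_sym (negPf ur).
- move=> w wr; rewrite /par'; case: eqP => [->|/eqP wu]; first by rewrite d'u.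
  by move=> E; apply: d0 => //; apply/eqP; rewrite -leqn0 -E le'.
move=> w wr; rewrite /par'; case: eqP => [->|/eqP wu]; first by rewrite d'u d'v.
move=> d'w; have dw : (0 < d w)%N.
  rewrite lt0n; apply: contraL d'w => /eqP E; rewrite -leqNgt leqn0 /d'.
  case: ifP => [a|_]; last exact/eqP.
  move: a; rewrite step // (d0 w wr E) => /connectP[p].
  have fx : par w = w := d0 w wr E.
  elim: p => [|x p IH] /=; first by move=> _ E1; rewrite E1 eqxx in wu.
  by rewrite fx => /andP[/eqP <-].
have [h1 h2 h3] := dS w wr dw; split=> //.
  by apply: leq_trans (le' _).
by rewrite /d' (step w wu); case: ifP => // _; rewrite h2 addSn.
Qed.

(** A tree with the largest sum of depths cannot be improved by [rehang]. *)
Lemma normal_tree : exists (r : V) (par : V -> V) (d : V -> nat),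
  [/\ d r = 1%N, par r = r, forall v, (0 < d v)%N,
      forall v, v != r -> d v = (d (par v)).+1 /\ touch (par v) v &
      forall f : edge G, anc par (src f) (tgt f) || anc par (tgt f) (src f)].
Proof.
have [/card_gt0P[r _] conn] := connG.
pose P n := `[< exists par d, partial_tree r par d /\ (\sum_w d w = n)%N >].
have exP : exists n, P n.
  exists (\sum_(w : V) (w == r))%N; apply/asboolP; exists id, (fun w => (w == r : nat)).
  by split=> //; split=> //; [rewrite eqxx|move=> v /negPf ->].
have bdP n : P n -> (n <= #|V| * #|V|)%N.
  move=> /asboolP[par [d [[dr parr d0 dS] <-]]].
  rewrite -sum_nat_const; apply: leq_sum => w _; apply: (depth_bound dr parr) => v vr dv.
  by have [] := dS v vr dv.
case: (ex_maxnP exP bdP) => n /asboolP[par [d [T En]]] maxn.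
have max u v : touch v u -> (0 < d v)%N -> (d u <= d v)%N -> anc par u v.
  move=> uv dv le; apply/negPn/negP => na.
  have [par' [d' [T']]] := rehang T uv dv le na.
  by rewrite En ltnNge => /negP[]; apply: maxn; apply/asboolP; exists par', d'.
have [dr parr d0 dS] := T.
have dS' w (wr : w != r) (dw : (0 < d w)%N) : (0 < d (par w))%N /\ d w = (d (par w)).+1.
  by have [] := dS w wr dw.
have dpos v : (0 < d v)%N.
  suff climb p u : (0 < d u)%N -> path touch u p -> (0 < d (last u p))%N.
    by have /connectP[p pth ->] := conn r v; apply: climb; rewrite ?dr.
  elim: p u => [|w p IH] u du //= /andP[uw pth]; apply: IH => //.
  rewrite lt0n; apply: contraL du => /eqP dw; rewrite -leqNgt leqn0.
  apply/negPn/negP; rewrite -lt0n => du.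
  have := max w u uw du; rewrite dw => /(_ isT) a.
  by have [_] := anc_depth dr parr dS' du a; rewrite dw.
exists r, par, d; split=> //.
  by move=> v vr; have [] := dS v vr (dpos v).
move=> f; have tf := adj_edge (in_setT f).
have [le|/ltnW le] := leqP (d (src f)) (d (tgt f)).
  by rewrite max // /touch adj_sym.
by rewrite orbC max.
Qed.

End NormalTree.

Definition directed_support (G : graph) (o : edge G -> int) (D : {set edge G}) :
    {ffun edge G -> int} := [ffun e => o e * (e \in D)%:Z].

Section FundamentalCycles.
Variable G : graph.
Hypothesis connG : connected_graph G.
Implicit Types (e f : edge G).

(** Directing the edges of a normal tree away from the root and the chords towards
    the root makes all fundamental cycles directed cycles. [lev f] is the
    depth of the upper end of the chord [f]; the fundamental cycles of two
    chords that start no lower than [f] and meet the one of [f] both pass through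
    its topmost tree edge. *)
Lemma directed_fundamental_cycles :
  exists (chord : {set edge G}) (D : edge G -> {set edge G}) (o : edge G -> int)
    (lev : edge G -> nat),
    [/\ [/\ (#|chord| + #|vert G| = #|edge G| + 1)%N,
        forall e, o e = 1 \/ o e = -1,
        forall f f', f \in chord -> f' \in chord -> (f' \in D f) = (f' == f) &
        forall f, f \in chord -> boundary (directed_support o (D f)) = 0],
        forall e, e \notin chord ->
          exists S : {set vert G}, cut S = e |: [set f in chord | e \in D f],
        forall S : {set vert G}, cut S \subset chord -> cut S = set0 &
        forall f f1 f2, f \in chord -> f1 \in chord -> f2 \in chord -> f1 != f -> f2 != f ->
          (lev f1 <= lev f)%N -> (lev f2 <= lev f)%N ->
          D f1 :&: D f != set0 -> D f2 :&: D f != set0 -> D f1 :&: D f2 :&: D f != set0].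
Proof.
have [r [par [d [dr parr dpos dS normal]]]] := normal_tree connG.
have dS' w (wr : w != r) (_ : (0 < d w)%N) : (0 < d (par w))%N /\ d w = (d (par w)).+1.
  by split; [exact: dpos|have [] := dS w wr].
have ends (v : {v : vert G | v != r}) : exists f,
    (src f = par (val v) /\ tgt f = val v) \/ (src f = val v /\ tgt f = par (val v)).
  have [_ /existsP[f /andP[_ Hf]]] := dS (val v) (valP v).
  by exists f; case/orP: Hf => /andP[/eqP <- /eqP <-]; [left|right].
have [pe Hpe] := choice ends.
have dval (v : {v : vert G | v != r}) : d (val v) = (d (par (val v))).+1.
  by have [] := dS (val v) (valP v).
have pe_inj : injective pe.
  move=> v w E; apply: val_inj; have dv := dval v; have dw := dval w.
  have := Hpe v; have := Hpe w; rewrite E.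
  move=> [[-> ->]|[-> ->]] [[h1 h2]|[h1 h2]] //.
    by have := congr1 d h1; have := congr1 d h2; lia.
  by have := congr1 d h1; have := congr1 d h2; lia.
pose chord := [set f | f \notin codom pe].
pose bot f := if anc par (src f) (tgt f) then tgt f else src f.
pose top f := if anc par (src f) (tgt f) then src f else tgt f.
have top_bot f : anc par (top f) (bot f).
  by rewrite /top /bot; have := normal f; case: ifP => //= ->.
pose D f : {set edge G} :=
  f |: [set pe w | w in [pred w | anc par (val w) (bot f) && ~~ anc par (val w) (top f)]].
(* Tree edges are directed from the parent to the child, chords from the lower to
   the upper end. *)
pose o e : int := if [exists v, (pe v == e) && (src e == par (val v))] then 1
   else if e \in codom pe then -1 else if src e == bot e then 1 else -1.
have peD w f : (pe w \in D f) =
    (pe w == f) || (anc par (val w) (bot f) && ~~ anc par (val w) (top f)).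
  by rewrite in_setU1 (mem_imset _ _ pe_inj).
have chord_pe f w : f \in chord -> (pe w == f) = false.
  by rewrite inE => fc; apply: contraNF fc => /eqP <-; apply: codom_f.
have not_chord e : e \notin chord -> exists w, e = pe w.
  by rewrite inE negbK => /codomP[w ->]; exists w.
have bd_pe w : boundary (edge1 (pe w) *~ o (pe w)) = vert1 (val w) - vert1 (par (val w)).
  have ne : val w <> par (val w) by move=> E; have := dval w; rewrite -E; lia.
  rewrite boundaryMz boundary_edge1 /o codom_f.
  have [[h1 h2]|[h1 h2]] := Hpe w.
    case: existsP => [_|[]]; first by rewrite mulr1z h1 h2.
    by exists w; rewrite eqxx h1 eqxx.
  case: existsP => [[w' /andP[/eqP/pe_inj -> /eqP]]|_]; first by rewrite h1.
  by rewrite mulrNz mulr1z h1 h2 opprB.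
have bd_chord f : f \in chord -> boundary (edge1 f *~ o f) = vert1 (top f) - vert1 (bot f).
  move=> fc; have fc' := fc; rewrite inE in fc'.
  rewrite boundaryMz boundary_edge1 /o (negPf fc').
  case: existsP => [[w /andP[E _]]|_]; first by rewrite chord_pe in E.
  rewrite /top /bot; case: (anc _ _ _); last by rewrite eqxx mulr1z.
  case: eqP => [E|_]; last by rewrite mulrNz mulr1z opprB.
  by rewrite E subrr mul0rz.
have o_unit e : o e = 1 \/ o e = -1.
  by rewrite /o; do ![case: ifP => _]; [left|right|left|right].
(* The directed tree path from the root to v. *)
pose y v := \sum_(w | anc par (val w) v) edge1 (pe w) *~ o (pe w).
have bd_y v : boundary (y v) = vert1 v - vert1 r.
  have := dpos v; move: v; apply: (anc_ind dS') => [|v vr _ IH].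
    rewrite subrr /y big1 ?boundary0 // => w /(anc_root parr) E.
    by have := valP w; rewrite E eqxx.
  pose w0 : {v : vert G | v != r} := Sub v vr.
  rewrite /y (bigD1 w0) ?anc_refl //= boundaryD bd_pe /=.
  rewrite (eq_bigl (fun w => anc par (val w) (par v))); first by rewrite IH addrA subrK.
  move=> w; rewrite [in LHS]anc_step -[w == w0]/(val w == v).
  case: eqP => [E|_] /=; last by rewrite andbT.
  apply/esym/negbTE/negP => a; have [h _] := anc_depth dr parr dS' (dpos _) a.
  by have [E1 _] := dS v vr; move: h; rewrite E E1 ltnn.
have y_pe v w : y v (pe w) = o (pe w) * (anc par (val w) v)%:Z.
  rewrite /y sum_ffunE (eq_bigr (fun w' => if w' == w then o (pe w) else 0)).
    rewrite -big_mkcondr big_mkcond (bigD1 w) //= big1 => [|w' /negPf ->]; last by rewrite andbF.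
    by rewrite eqxx andbT addr0; case: (anc _ _ _); rewrite ?mulr1 ?mulr0.
  move=> w' _.
  rewrite ffunMzE ffunE (inj_eq pe_inj) eq_sym; case: eqP => [->|_]; rewrite ?mul0rz //.
  by rewrite intz.
have y_chord v c : c \in chord -> y v c = 0.
  move=> cc; rewrite /y sum_ffunE big1 // => w _.
  by rewrite ffunMzE ffunE eq_sym chord_pe // mul0rz.
exists chord, D, o, (fun f => d (top f)); split; first split=> //.
- have E1 : #|codom pe| = #|{: {v : vert G | v != r}}| := card_codom pe_inj.
  have E2 : (#|{: {v : vert G | v != r}}| + 1 = #|vert G|)%N.
    have C1 : #|[pred x | x != r]| = #|vert G|.-1.
      by rewrite -(cardC1 r); apply: eq_card => x; rewrite !inE.
    by rewrite card_sig C1 addn1 prednK //; apply/card_gt0P; exists r.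
  have := cardC (mem (codom pe)); rewrite E1 -E2.
  have -> : #|[predC codom pe]| = #|chord| by apply: eq_card => f; rewrite !inE.
  by move=> <-; lia.
- move=> f f' fc f'c; rewrite in_setU1; case: eqP => //= _.
  by apply/imsetP => -[w _ E]; have := chord_pe f' w f'c; rewrite E eqxx.
- move=> f fc.
  suff -> : directed_support o (D f) = edge1 f *~ o f + y (bot f) - y (top f).
    by rewrite !boundaryD boundaryN bd_chord // !bd_y; apply/ffunP => v; rewrite !ffunE; ring.
  apply/ffunP => e; rewrite ffunE; have [ec|/not_chord[w ->]] := boolP (e \in chord).
    rewrite !ffunE ffunMzE !ffunE !y_chord // subr0 addr0 in_setU1.
    have -> : (e \in [set pe w | w in [pred w | anc par (val w) (bot f) &&
               ~~ anc par (val w) (top f)]]) = false.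
      by apply/imsetP => -[w _ E]; have := chord_pe e w ec; rewrite E eqxx.
    by rewrite orbF; case: eqP => [->|_]; rewrite ?mulr1 ?mulr0 ?mul0rz ?intz.
  rewrite !ffunE ffunMzE !ffunE !y_pe peD chord_pe //= mul0rz add0r -mulrBr; congr (_ * _).
  have : anc par (val w) (top f) -> anc par (val w) (bot f).
    by move=> a; apply: anc_trans a (top_bot f).
  by case: (anc _ _ (top f)); case: (anc _ _ (bot f)) => // /(_ isT).
- move=> e /not_chord[w ->]; exists [set v | anc par (val w) v].
  apply/setP => f; rewrite !inE.
  have [fc|/not_chord[w' ->]] := boolP (f \in chord); last first.
    have -> : (pe w' \notin codom pe) = false by rewrite codom_f.
    rewrite orbF (inj_eq pe_inj).
    have -> : (anc par (val w) (src (pe w')) != anc par (val w) (tgt (pe w'))) =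
      (anc par (val w) (par (val w')) != anc par (val w) (val w')).
      by have [[-> ->]|[-> ->]] := Hpe w'; rewrite // eq_sym.
    rewrite (anc_step _ _ (val w')) (inj_eq val_inj) (eq_sym w' w).
    have [E|_] := eqVneq w w'; last by rewrite /= eqxx.
    rewrite -E; case a: (anc _ _ _) => //.
    have [h _] := anc_depth dr parr dS' (dpos _) a.
    by have := dval w; move: h; lia.
  have fc' := fc; rewrite inE in fc'; rewrite fc' (eq_sym f) chord_pe //=.
  have -> : (anc par (val w) (src f) != anc par (val w) (tgt f)) =
      (anc par (val w) (bot f) != anc par (val w) (top f)).
    by rewrite /bot /top; case: (anc par (src f) (tgt f)); rewrite // eq_sym.
  rewrite (mem_imset _ _ pe_inj) inE /=.
  have : anc par (val w) (top f) -> anc par (val w) (bot f).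
    by move=> a; apply: anc_trans a (top_bot f).
  by case: (anc _ _ (top f)); case: (anc _ _ (bot f)) => // /(_ isT).
- move=> S sS.
  have same v : (v \in S) = (r \in S).
    have := dpos v; move: v; apply: (anc_ind dS') => // v vr _ <-.
    pose w : {v : vert G | v != r} := Sub v vr.
    have : pe w \notin cut S.
      by apply: contraTN (codom_f pe w) => /(subsetP sS); rewrite inE.
    by rewrite inE negbK; have [[-> ->]|[-> ->]] := Hpe w => /eqP.
  by apply/setP => f; rewrite !inE !(same (src f), same (tgt f)) eqxx.
move=> f f1 f2 fc f1c f2c f1f f2f le1 le2.
(* The tree edge of f just below its upper end is common to f and f'. *)
have meet f' : f' \in chord -> f' != f -> (d (top f') <= d (top f))%N ->
    D f' :&: D f != set0 ->
    exists w, [/\ pe w \in D f', pe w \in D f & d (val w) = (d (top f)).+1].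
  move=> f'c f'f le /set0Pn[e]; rewrite in_setI => /andP[e1 e2].
  have [ec|/not_chord[w Ew]] := boolP (e \in chord).
    have in_chord g : g \in chord -> e \in D g -> e = g.
      move=> gc; rewrite in_setU1 => /orP[/eqP//|/imsetP[w _ E]].
      by have := chord_pe e w ec; rewrite E eqxx.
    by case/eqP: f'f; rewrite -(in_chord f') // -(in_chord f).
  rewrite Ew !peD !chord_pe //= in e1 e2.
  case/andP: e1 => wb' wt'; case/andP: e2 => wb wt.
  have lt : (d (top f) < d (val w))%N.
    rewrite ltnNge; apply: contra wt => le'.
    exact: (anc_comparable dr parr dS' (dpos (bot f))).
  (* u is the child of top f on the tree path to the lower end of f. *)
  have [|u uw du] := anc_level dr dS' (v := val w) (k := (d (top f)).+1) (dpos _).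
    by rewrite lt.
  have ur : u != r.
    by apply: contra_eq_neq du => ->; rewrite dr; apply/eqP => -[E]; have := dpos (top f); rewrite -E.
  have no g : (d (top g) <= d (top f))%N -> ~~ anc par u (top g).
    move=> leg; apply/negP => a; have [h _] := anc_depth dr parr dS' (dpos _) a.
    by move: (leq_trans h leg); rewrite du ltnn.
  exists (Sub u ur); rewrite !peD !chord_pe //= !no // !andbT.
  by split=> //; [apply: anc_trans uw wb'|apply: anc_trans uw wb].
move=> /(meet f1 f1c f1f le1)[w1 [a1 b1 c1]] /(meet f2 f2c f2f le2)[w2 [a2 b2 c2]].
have E : w1 = w2.
  move: b1 b2; rewrite !peD !chord_pe //= => /andP[b1 _] /andP[b2 _].
  apply: val_inj; apply: (anc_eq dr parr dS' (dpos _)); last by rewrite c1 c2.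
  by apply: (anc_comparable dr parr dS' (dpos _) b1 b2); rewrite c1 c2.
by apply/set0Pn; exists (pe w1); rewrite !in_setI a1 b1 E a2.
Qed.

End FundamentalCycles.

(** * Period forms *)

Section Coedges.
Variables (g : nat) (G : graph) (phi : {additive 'cV[int]_g -> {ffun edge G -> int}}).
Implicit Types (f : edge G) (x : 'cV[int]_g).

Lemma coedgeE f x : (coedge phi f *m x) 0 0 = phi x f.
Proof.
have -> : phi x f = phi (\sum_i delta_mx i 0 *~ x i 0) f.
  congr (phi _ f); apply/matrixP => i j; rewrite summxE (ord1 j).
  have mxMz (M : 'cV[int]_g) k : (M *~ k) i 0 = M i 0 *~ k.
    by case: k => n; rewrite ?NegzE ?mulrNz ?mxE -!pmulrn mulmxnE.
  rewrite (bigD1 i) //= mxMz mxE !eqxx intz big1 ?addr0 // => k /negPf ki.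
  by rewrite mxMz mxE eq_sym ki mul0rz.
rewrite raddf_sum sum_ffunE mxE; apply: eq_bigr => i _.
by rewrite raddfMz ffunMzE mxE mulrzz.
Qed.

Lemma pairing_parity (c : 'rV[int]_g) x :
  pairing (coparity c) (parity x) = ((c *m x) 0 0)%:~R.
Proof. by rewrite /pairing /coparity /parity -map_mxM /scalar_of mxE. Qed.

Lemma pairing_coedge f x : pairing (coparity (coedge phi f)) (parity x) = (phi x f)%:~R.
Proof. by rewrite pairing_parity coedgeE. Qed.

End Coedges.

Lemma odd_intr_F2 (n : int) : (n%:~R == 1 :> 'F_2) = odd `|n|.
Proof. by rewrite intr_F2; case: (odd _). Qed.

Lemma unit_sqr (R : realType) (n : int) : `|n| <= 1 ->
  (n%:~R : R) ^+ 2 = (n%:~R == 1 :> 'F_2)%:R.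
Proof.
move=> n1; rewrite odd_intr_F2.
have [->|[->|->]] : n = 0 \/ n = 1 \/ n = -1 by lia.
- by rewrite expr0n.
- by rewrite expr1n.
by rewrite mulrNz sqrrN expr1n.
Qed.

Lemma odd_le_sqr (R : realType) (n : int) : (n%:~R == 1 :> 'F_2)%:R <= (n%:~R : R) ^+ 2.
Proof.
rewrite odd_intr_F2 -rmorphXn /= [X in X <= _](pmulrn (1 : R) (odd `|n|)) ler_int.
have : 0 <= n ^+ 2 by apply: sqr_ge0.
have [->|n0] := eqVneq n 0; first by [].
have : 0 < n ^+ 2 by rewrite exprn_even_gt0.
by case: (odd _); lia.
Qed.

Lemma sqr_le_odd (R : realType) (n : int) :
  (n%:~R : R) ^+ 2 = (n%:~R == 1 :> 'F_2)%:R -> `|n| <= 1.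
Proof.
rewrite odd_intr_F2 -rmorphXn /= [RHS](pmulrn (1 : R) (odd `|n|)) => /eqP.
rewrite eqr_int => /eqP E; have : n ^+ 2 <= 1 by rewrite E; case: (odd _).
by rewrite -[n ^+ 2]real_normK ?num_real // expr_le1.
Qed.

Section Realization.
Variables (R : realType) (g : nat) (Q : 'M[R]_g).
Hypothesis posQ : posdef_form Q.
Variables (Gamma : metric_graph R)
  (phi : {additive 'cV[int]_g -> {ffun edge Gamma -> int}}).
Hypothesis real : realizes Q phi.
Implicit Types (f : edge Gamma) (x : 'cV[int]_g) (e : 'rV['F_2]_g) (alpha : 'cV['F_2]_g).

Local Notation cls f := (coparity (coedge phi f)).

Lemma phi_boundary x : boundary (phi x) = 0.
Proof. by have [_ [_ H] _] := real; apply/H; exists x. Qed.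

Lemma phi_onto z : boundary z = 0 -> exists x, phi x = z.
Proof. by have [_ [_ H] _] := real; move/H. Qed.

Lemma unit_representative alpha :
  exists2 x, parity x = alpha & forall f, `|phi x f| <= 1.
Proof.
have [x0 <-] := parity_surj alpha.
have [y [y0 Hy]] := unit_lift (phi_boundary x0).
have [u Eu] := phi_onto y0; exists (x0 - (u + u)).
  by rewrite parityD parityN parityD matrix_F2_addxx addr0.
by move=> f; rewrite raddfB raddfD Eu.
Qed.

(** The square of an integer is at least the indicator of its oddness, with equality for
    0, 1 and -1. *)
Lemma vonorm_period alpha :
  vonorm Q alpha = \sum_f len f * (pairing (cls f) alpha == 1)%:R.
Proof.
have [_ _ HQ] := real.
apply/le_anti/andP; split.
  have [x <- Hx] := unit_representative alpha.
  apply: le_trans (vonorm_le posQ x) _; rewrite HQ /period_form.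
  by apply: ler_sum => f _; rewrite pairing_coedge unit_sqr.
have [x <- Hx] := shortest_exists posQ alpha.
rewrite -[leRHS]Hx HQ /period_form; apply: ler_sum => f _.
by rewrite pairing_coedge ler_pM2l ?len_gt0 // odd_le_sqr.
Qed.

(** A vector with a coordinate outside of 0, 1 and -1 is longer than the unit
    representative of its class. *)
Lemma shortest_unit x f : shortest Q x -> `|phi x f| <= 1.
Proof.
have [_ _ HQ] := real; rewrite /shortest HQ vonorm_period /period_form => E.
have Z : \sum_f len f * ((phi x f)%:~R ^+ 2 - ((phi x f)%:~R == 1 :> 'F_2)%:R) = 0.
  under eq_bigr do rewrite mulrBr.
  rewrite sumrB E; under [X in _ - X]eq_bigr do rewrite -pairing_coedge.
  by rewrite subrr.
have ge0 f' : 0 <= len f' * ((phi x f')%:~R ^+ 2 - ((phi x f')%:~R == 1 :> 'F_2)%:R).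
  by rewrite mulr_ge0 ?subr_ge0 ?odd_le_sqr // ltW // len_gt0.
have /eqP : len f * ((phi x f)%:~R ^+ 2 - ((phi x f)%:~R == 1 :> 'F_2)%:R) = 0.
  by apply: (psumr_eq0P (fun f' _ => ge0 f') Z).
rewrite mulf_eq0 gt_eqF ?len_gt0 //= subr_eq0 => /eqP.
exact: sqr_le_odd.
Qed.

Lemma conorm_period e : e != 0 -> conorm Q e = \sum_(f | cls f == e) len f.
Proof.
move=> e0; apply: (conorm_unique (w := fun e => \sum_(f | cls f == e) len f)) => //.
move=> alpha; rewrite vonorm_period.
have -> : \sum_f len f * (pairing (cls f) alpha == 1)%:R =
    \sum_(f | pairing (cls f) alpha == 1) len f.
  by rewrite [RHS]big_mkcond; apply: eq_bigr => f _; case: eqP; rewrite ?mulr1 ?mulr0.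
rewrite (partition_big (fun f => cls f) (fun e => pairing e alpha == 1)) //=.
apply: eq_bigr => e' pe'; apply: eq_bigl => f.
by have [->|_] := eqVneq (cls f) e'; rewrite ?pe' ?andbF.
Qed.

Lemma period_conorms_ge0 : conorms_ge0 Q.
Proof.
by move=> e e0; rewrite conorm_period //; apply: sumr_ge0 => f _; apply/ltW/len_gt0.
Qed.

Lemma nonbridge_unit f : ~~ bridge f -> exists x, phi x f = 1.
Proof. by move=> /nonbridge_cycle[z /phi_onto[x <-] zf]; exists x. Qed.

Lemma cls_eq0 f : (cls f == 0) = bridge f.
Proof.
apply/eqP/idP => [E|br].
  apply: contraT => /nonbridge_unit[x xf].
  by have := pairing_coedge phi f x; rewrite E pairing0l xf => /eqP; rewrite eq_sym oner_eq0.
apply: covector_ext => alpha; have [x <-] := parity_surj alpha.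
by rewrite pairing0l pairing_coedge (bridge_cycle br (phi_boundary x)).
Qed.

Lemma csupp_period : [set cls f | f in [pred f | ~~ bridge f]] = csupp Q.
Proof.
apply/setP => e; rewrite [RHS]inE; apply/imsetP/andP => [[f nb ->]|[e0]].
  have nb0 : cls f != 0 by rewrite cls_eq0; exact: nb.
  split=> //.
  rewrite conorm_period // (bigD1 f) //=; apply: ltr_wpDr; last exact: len_gt0.
  by apply: sumr_ge0 => f' _; apply/ltW/len_gt0.
rewrite conorm_period // => pos.
have [f Ef] : exists f, cls f == e.
  by apply/existsP; apply: contraLR pos => /existsPn no; rewrite big_pred0 ?ltxx // => f; apply/negbTE.
have nb : ~~ bridge f by rewrite -cls_eq0 (eqP Ef).
by exists f; rewrite ?(eqP Ef).
Qed.

Lemma conorm_nonbridge e : e \in csupp Q ->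
  conorm Q e = \sum_(f | ~~ bridge f && (cls f == e)) len f.
Proof.
rewrite inE => /andP[e0 _]; rewrite conorm_period //; apply: eq_bigl => f.
by have [E|_] := eqVneq (cls f) e; rewrite ?andbF // -cls_eq0 E e0.
Qed.

Local Notation Et := {e : 'rV['F_2]_g | e \in csupp Q}.

(** The edges outside of a set of representatives of the classes of coedges are
    contracted: the dual of a contraction is a restriction of the dual. *)
Lemma csupp_cographic : cographic (binary_matroid (csupp Q)).
Proof.
have ex_rep (e : Et) : exists f, cls f = val e.
  have : val e \in [set cls f | f in [pred f | ~~ bridge f]] by rewrite csupp_period; apply: valP.
  move=> /imsetP[f _ E].
  by exists f.
have [rep Hrep] := choice ex_rep.
have rep_inj : injective rep by move=> e e' E; apply: val_inj; rewrite -!Hrep E.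
pose X := ~: (rep @: [set: Et]).
pose rt := fingraph.root (adj X).
pose G' := @Graph (vert Gamma) Et (fun e : Et => rt (src (rep e))) (fun e : Et => rt (tgt (rep e))).
apply/cographicP; exists G', id; split; first by exists id.
move=> T; rewrite imset_id.
have symX := @connect_adj_sym Gamma X.
have sumP : \sum_(e in T) val e = 0 <->
    (forall z, boundary z = 0 -> exists k, \sum_(f in rep @: T) z f = k + k).
  have sumE x : pairing (\sum_(e in T) val e) (parity x) =
      (\sum_(f in rep @: T) phi x f)%:~R.
    rewrite pairing_suml rmorph_sum /= big_imset /=; last by move=> ? ? _ _; apply: rep_inj.
    by apply: eq_bigr => e _; rewrite -Hrep pairing_coedge.
  split=> [T0 z /phi_onto[x <-]|H].
    have := sumE x; rewrite T0 pairing0l -[LHS]/((0 : int)%:~R) => /esym/eq_F2_double[k].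
    by rewrite subr0 => ->; exists k.
  apply: covector_ext => alpha; have [x <-] := parity_surj alpha.
  have [k Ek] := H _ (phi_boundary x).
  by rewrite pairing0l sumE Ek rmorphD /= F2_addxx.
rewrite sumP; split.
  move=> /(orthogonal_cut (mgraph_connected Gamma))[S ES]; exists S.
  have disX : [disjoint X & cut S].
    rewrite -ES disjoint_sym disjoints_subset setCK.
    by apply/subsetP => _ /imsetP[e _ ->]; apply: imset_f.
  have rtS v : (rt v \in S) = (v \in S).
    by apply/esym/(cut_disjointP disX)/connect_root.
  apply/setP => e; rewrite inE /= !rtS.
  by rewrite -(mem_imset _ _ rep_inj) ES inE.
move=> [S ES] z z0; suff -> : rep @: T = cut [set v | rt v \in S] by apply: cut_even.
apply/setP => f; rewrite !inE.
have [fX|] := boolP (f \in X).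
  have -> : rt (src f) = rt (tgt f) by apply/fingraph.rootP/connect1/adj_edge.
  rewrite eqxx; apply/negbTE; apply: contraL fX => /imsetP[e _ ->].
  by rewrite inE negbK; apply: imset_f.
rewrite inE negbK => /imsetP[e _ ->].
by rewrite (mem_imset _ _ rep_inj) ES inE.
Qed.

End Realization.

(** * From a cographic support to a period form *)

(** The data of a normal tree of a graph whose cuts are the vanishing sums over the
    support: [v] labels the edges by the support, [D f] is the fundamental cycle of
    the chord [f] and [o] its orientation. *)
Section Core.
Variables (R : realType) (g : nat) (Q : 'M[R]_g).
Hypothesis posQ : posdef_form Q.
Hypothesis ge0Q : conorms_ge0 Q.
Variable G : graph.
Hypothesis connG : connected_graph G.
Variable v : edge G -> 'rV['F_2]_g.
Hypothesis v_inj : injective v.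
Hypothesis v_csupp : v @: [set: edge G] = csupp Q.
Hypothesis v_cut : forall T : {set edge G},
  \sum_(f in T) v f = 0 <-> exists S, T = cut S.
Variables (chord : {set edge G}) (D : edge G -> {set edge G}) (o : edge G -> int).
Hypothesis o_unit : forall e, o e = 1 \/ o e = -1.
Hypothesis D_chord : forall f f', f \in chord -> f' \in chord -> (f' \in D f) = (f' == f).
Hypothesis tree_cut : forall e, e \notin chord ->
  exists S, cut S = e |: [set f in chord | e \in D f].
Hypothesis chord_cut : forall S, cut S \subset chord -> cut S = set0.

Local Notation Ch := {f : edge G | f \in chord}.
Implicit Types (e f : edge G) (i j k : Ch) (alpha beta : 'cV['F_2]_g).

Lemma v_in e : v e \in csupp Q.
Proof. by rewrite -v_csupp imset_f. Qed.

(** The sum over the fundamental cut of the tree edge vanishes. *)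
Lemma tree_edge_sum e : e \notin chord ->
  v e = \sum_(f in [set f in chord | e \in D f]) v f.
Proof.
move=> ec; have [S ES] := tree_cut ec.
have : \sum_(f in cut S) v f = 0 by apply/v_cut; exists S.
rewrite ES big_setU1 /=; last by rewrite !inE (negPf ec).
by move/eqP; rewrite addr_F2_eq0 => /eqP.
Qed.

Lemma chord_coordinates alpha beta :
  (forall i, pairing (v (val i)) alpha = pairing (v (val i)) beta) -> alpha = beta.
Proof.
move=> H; apply: (vector_ext_csupp posQ ge0Q) => e.
have Hc f : f \in chord -> pairing (v f) alpha = pairing (v f) beta.
  by move=> fc; have := H (Sub f fc).
rewrite -v_csupp => /imsetP[f _ ->].
have [|fc] := boolP (f \in chord); first exact: Hc.
rewrite (tree_edge_sum fc) !pairing_suml; apply: eq_bigr => f'.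
by rewrite inE => /andP[/Hc].
Qed.

(** The chords are independent, as they contain no cut, and by [chord_coordinates]
    they span; counting vectors and sets of chords turns this into a basis. *)
Lemma chord_basis : #|chord| = g /\
  exists al : Ch -> 'cV['F_2]_g, forall i j, pairing (v (val j)) (al i) = (j == i)%:R.
Proof.
pose Phi alpha : {ffun Ch -> 'F_2} := [ffun i => pairing (v (val i)) alpha].
pose Psi (T : {set Ch}) : 'rV['F_2]_g := \sum_(i in T) v (val i).
have Phi_inj : injective Phi.
  by move=> a b /ffunP E; apply: chord_coordinates => i; have := E i; rewrite !ffunE.
have Psi_inj : injective Psi.
  move=> T T' E; pose U := (T :\: T') :|: (T' :\: T).
  have : \sum_(f in val @: U) v f = 0.
    rewrite big_imset /=; last by move=> ? ? _ _; apply: val_inj.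
    by rewrite (sum_symdiff (fun i : Ch => v (val i))) -/(Psi T) -/(Psi T') E matrix_F2_addxx.
  move=> /v_cut[S ES]; have : val @: U = set0.
    by rewrite ES; apply: chord_cut; rewrite -ES; apply/subsetP => _ /imsetP[i _ ->]; apply: valP.
  move=> /eqP; rewrite imset_eq0 => /eqP U0; apply/setP => i.
  by have /setP/(_ i) := U0; rewrite !inE; case: (i \in T); case: (i \in T').
have cardCh : #|{: Ch}| = #|chord| by rewrite card_sig.
have le1 : (2 ^ #|chord| <= 2 ^ g)%N.
  have := leq_card _ Psi_inj; rewrite card_mx card_Fp // mul1n.
  by rewrite -cardsT -powersetT card_powerset cardsT cardCh.
have le2 : (2 ^ g <= 2 ^ #|chord|)%N.
  by have := leq_card _ Phi_inj; rewrite card_mx card_ffun card_Fp // muln1 cardCh.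
have Eg : #|chord| = g.
  have exp2 m n : (2 ^ m <= 2 ^ n)%N -> (m <= n)%N by rewrite leq_exp2l.
  by apply/eqP; rewrite eqn_leq; apply/andP; split; apply: exp2.
split=> //.
have onto (i : Ch) : exists a, Phi a = [ffun j => (j == i)%:R].
  have := inj_card_onto Phi_inj; rewrite card_mx card_ffun card_Fp // muln1 cardCh Eg leqnn.
  by move=> /(_ isT [ffun j => (j == i)%:R])/codomP[a ->]; exists a.
have [al Hal] := choice onto; exists al => i j.
by have /ffunP/(_ j) := Hal i; rewrite !ffunE.
Qed.

Variable al : Ch -> 'cV['F_2]_g.
Hypothesis al_dual : forall i j, pairing (v (val j)) (al i) = (j == i)%:R.

Lemma F2_nat1 (b : bool) : ((b%:R : 'F_2) == 1) = b.
Proof. by case: b. Qed.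

Lemma al_D i e : pairing (v e) (al i) = (e \in D (val i))%:R.
Proof.
have [ec|ec] := boolP (e \in chord).
  by rewrite (al_dual i (Sub e ec)) D_chord //; apply: valP.
rewrite (tree_edge_sum ec) pairing_suml.
have step f : f \in [set f in chord | e \in D f] ->
    pairing (v f) (al i) = (if f == val i then 1 else 0).
  by rewrite inE => /andP[fc _]; rewrite (al_dual i (Sub f fc)) -val_eqE /=; case: eqP.
rewrite (eq_bigr _ step) -big_mkcondr /=.
case: (boolP (e \in D (val i))) => ei.
  rewrite (big_pred1 (val i)) // => f; rewrite inE.
  have ci : val i \in chord := valP i.
  by rewrite [RHS]/=; have [->|_] := eqVneq f (val i); rewrite ?andbF ?ci ?ei.
rewrite big_pred0 // => f; rewrite inE.
by have [->|_] := eqVneq f (val i); rewrite ?(negPf ei) ?andbF.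
Qed.

Lemma Dset_al i : Dset Q (al i) = v @: D (val i).
Proof.
apply/setP => e; rewrite in_Dset; apply/andP/imsetP => [[]|[f fD ->]].
  rewrite -{1}v_csupp => /imsetP[f _ ->]; rewrite al_D F2_nat1 => fD.
  by exists f.
by rewrite v_in al_D F2_nat1.
Qed.

Definition chain (c : Ch -> int) : {ffun edge G -> int} :=
  \sum_i directed_support o (D (val i)) *~ c i.

Lemma chainE c e : chain c e = \sum_i o e * (e \in D (val i))%:Z * c i.
Proof.
rewrite /chain sum_ffunE; apply: eq_bigr => i _.
by rewrite ffunMzE ffunE mulrzz.
Qed.

Lemma o_sqr e : o e * o e = 1.
Proof. by have [->|->] := o_unit e. Qed.

Lemma chain_chord c i : chain c (val i) = o (val i) * c i.
Proof.
rewrite chainE (bigD1 i) //= D_chord ?(valP i) // eqxx mulr1 big1 ?addr0 // => j ji.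
by rewrite D_chord ?(valP i) ?(valP j) // val_eqE eq_sym (negPf ji) mulr0 mul0r.
Qed.

(** A tree edge is the only tree edge of its fundamental cut, so the flow through it is
    determined by the chords. *)
Lemma cycle_chords (z : {ffun edge G -> int}) :
  boundary z = 0 -> (forall i, z (val i) = 0) -> z = 0.
Proof.
move=> z0 zc; apply/ffunP => e; rewrite [RHS]ffunE.
have [ec|ec] := boolP (e \in chord); first exact: (zc (Sub e ec)).
have [S ES] := tree_cut ec; have := cycle_cut S z0.
rewrite ES big_setU1 /=; last by rewrite inE (negPf ec).
rewrite big1 ?addr0 => [|f]; last first.
  by rewrite inE => /andP[fc _]; rewrite (zc (Sub f fc)) mul0rz.
case: ifP => _; first by rewrite mulr1z.
by rewrite mulrNz mulr1z => /eqP; rewrite oppr_eq0 => /eqP.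
Qed.

Hypothesis D_cycle : forall f, f \in chord -> boundary (directed_support o (D f)) = 0.

Lemma boundary_chain c : boundary (chain c) = 0.
Proof.
rewrite /chain boundary_sum big1 // => i _.
by rewrite boundaryMz D_cycle ?mul0rz //; apply: valP.
Qed.

Lemma cycle_chain z : boundary z = 0 -> z = chain (fun i => o (val i) * z (val i)).
Proof.
move=> z0; apply/eqP; rewrite -subr_eq0; apply/eqP/cycle_chords.
  by rewrite boundaryD boundaryN z0 boundary_chain subr0.
by move=> i; rewrite !ffunE chain_chord mulrA o_sqr mul1r subrr.
Qed.

Variable r : Ch -> 'cV[int]_g.
Hypothesis r_par : forall i, parity (r i) = al i.
Hypothesis r_gram : forall i j, bilZ Q (r i) (r j) =
  \sum_e conorm Q (v e) * ((e \in D (val i))%:R * (e \in D (val j))%:R).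

Definition comb (c : Ch -> int) : 'cV[int]_g := \sum_i r i *~ c i.

Lemma combB c c' : comb (fun i => c i - c' i) = comb c - comb c'.
Proof. by rewrite /comb -sumrB; apply: eq_bigr => i _; rewrite mulrzBr. Qed.

Lemma chainB c c' : chain (fun i => c i - c' i) = chain c - chain c'.
Proof. by rewrite /chain -sumrB; apply: eq_bigr => i _; rewrite mulrzBr. Qed.

Lemma bilZ_suml (I : Type) (s : seq I) (F : I -> 'cV[int]_g) (m : I -> int) y :
  bilZ Q (\sum_(i <- s) F i *~ m i) y = \sum_(i <- s) (m i)%:~R * bilZ Q (F i) y.
Proof.
have Mz x n : bilZ Q (x *~ n) y = n%:~R * bilZ Q x y.
  have nat_case x' p : bilZ Q (x' *+ p) y = p%:R * bilZ Q x' y.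
    by elim: p => [|p IH]; rewrite ?bilZ0l ?mul0r // !mulrS bilZDl IH mulrDl mul1r.
  by case: n => p; rewrite ?NegzE ?mulrNz ?bilZNl ?mulNr -!pmulrn nat_case.
elim: s => [|i s IH]; first by rewrite !big_nil bilZ0l.
by rewrite !big_cons bilZDl IH Mz.
Qed.

Lemma quadZ_comb c :
  quadZ Q (comb c) = \sum_e conorm Q (v e) * ((chain c e)%:~R) ^+ 2.
Proof.
rewrite quadZ_bil /comb bilZ_suml.
have E1 e : (chain c e)%:~R = (o e)%:~R * \sum_i (e \in D (val i))%:R * (c i)%:~R :> R.
  rewrite chainE rmorph_sum big_distrr /=; apply: eq_bigr => i _.
  by rewrite !rmorphM /= -mulrA -pmulrn.
have sq e : ((chain c e)%:~R : R) ^+ 2 =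
    \sum_i (\sum_j (c i)%:~R * ((c j)%:~R * ((e \in D (val i))%:R * (e \in D (val j))%:R))).
  rewrite E1 exprMn -rmorphXn /= expr2 o_sqr mul1r expr2 big_distrl /=.
  apply: eq_bigr => i _; rewrite big_distrr /=; apply: eq_bigr => j _.
  by ring.
under [RHS]eq_bigr do rewrite sq big_distrr /=.
rewrite exchange_big /=; apply: eq_bigr => i _.
rewrite bilZC // bilZ_suml big_distrr /=.
under [RHS]eq_bigr do rewrite big_distrr /=.
rewrite exchange_big /=; apply: eq_bigr => j _.
rewrite bilZC // r_gram 2!big_distrr /=; apply: eq_bigr => e _.
by ring.
Qed.

Lemma parity_comb c : parity (comb c) = \sum_i (c i)%:~R *: al i.
Proof.
rewrite /comb; have -> (s : seq Ch) :
    parity (\sum_(i <- s) r i *~ c i) = \sum_(i <- s) (c i)%:~R *: al i.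
  have Mz x n : parity (x *~ n) = n%:~R *: (parity x : 'cV['F_2]_g).
    apply/matrixP => i j; rewrite !mxE.
    have mxMz : (x *~ n) i j = x i j *~ n.
      by case: n => p; rewrite ?NegzE ?mulrNz ?mxE -!pmulrn mulmxnE.
    by rewrite mxMz mulrzz rmorphM mulrC.
  by elim: s => [|i s IH]; rewrite ?big_nil ?parity0 // !big_cons parityD IH Mz r_par.
by [].
Qed.

Lemma chain_parity c e : (chain c e)%:~R = pairing (v e) (parity (comb c)).
Proof.
rewrite parity_comb pairing_sumr chainE rmorph_sum /=; apply: eq_bigr => i _.
have -> : pairing (v e) ((c i)%:~R *: al i) = (c i)%:~R * pairing (v e) (al i).
  by rewrite /pairing /scalar_of -scalemxAr mxE.
rewrite al_D !rmorphM /= mulrC -pmulrn; congr (_ * _).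
by have [->|->] := o_unit e; rewrite ?mul1r // mulrNz F2_opp mul1r.
Qed.

(** The classes of the [r i] span modulo two, and by the lift of cycles to coordinates
    0, 1 and -1 each class then contains a shortest vector that is a combination
    of the [r i], as the descent requires. *)
Lemma comb_onto x : exists c, x = comb c.
Proof.
apply: (halving_descent posQ (K := fun x => exists c, x = comb c) (K' := fun=> True)) => //.
- by exists (fun=> 0); rewrite /comb big1 // => i _; rewrite mulr0z.
- by move=> _ _ [c ->] [c' ->]; exists (fun i => c i - c' i); rewrite combB.
move=> {}x _; set alpha := parity x.
pose c0 i : int := (pairing (v (val i)) alpha == 1)%:Z.
have [y [y0 Hy]] := unit_lift (boundary_chain c0).
set z := chain c0 - (y + y) in Hy.
have z0 : boundary z = 0 by rewrite boundaryD boundaryN boundaryD y0 addr0 subr0 boundary_chain.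
pose c i := o (val i) * z (val i); have Ez : z = chain c := cycle_chain z0.
have Pc : parity (comb c) = alpha.
  apply: chord_coordinates => i; rewrite -chain_parity -Ez !ffunE rmorphB rmorphD /= F2_addxx subr0.
  rewrite chain_chord rmorphM /= /c0 -pmulrn -F2_eqb.
  by have [->|->] := o_unit (val i); rewrite ?mul1r // mulrNz F2_opp mul1r.
exists (comb c); split; [by exists c|exact: Pc|].
suff -> : quadZ Q (comb c) = vonorm Q alpha by apply: vonorm_le.
rewrite quadZ_comb massE //.
have -> : mass Q (Dset Q alpha) = \sum_(e in csupp Q) conorm Q e * (pairing e alpha == 1)%:R.
  by apply: mass_filter => e //; rewrite in_Dset.
rewrite -v_csupp big_imset /=; last by move=> ? ? _ _; apply: v_inj.
rewrite [RHS]big_mkcond /=; apply: eq_bigr => e _; rewrite in_setT -Ez.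
by rewrite unit_sqr // {1}Ez chain_parity Pc.
Qed.

Lemma comb_inj c c' : comb c = comb c' -> c =1 c'.
Proof.
move=> E; have : comb (fun i => c i - c' i) = 0 by rewrite combB E subrr.
move=> /(congr1 (quadZ Q)); rewrite quadZ0 quadZ_comb => Z i.
have ge0 e : 0 <= conorm Q (v e) * ((chain (fun i => c i - c' i) e)%:~R) ^+ 2.
  by rewrite mulr_ge0 ?sqr_ge0 // ltW // conorm_gt0 // v_in.
have /eqP : conorm Q (v (val i)) * ((chain (fun i => c i - c' i) (val i))%:~R) ^+ 2 = 0.
  by apply: (psumr_eq0P (fun e _ => ge0 e) Z).
rewrite mulf_eq0 gt_eqF ?conorm_gt0 ?v_in //= expf_eq0 /= intr_eq0 chain_chord.
by case: (o_unit (val i)) => ->; rewrite ?mul1r ?mulN1r ?oppr_eq0 subr_eq0 => /eqP.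
Qed.

Hypothesis card_tree : (#|chord| + #|vert G| = #|edge G| + 1)%N.
Hypothesis card_chord : #|chord| = g.

Definition realized_graph : metric_graph R :=
  @MetricGraph R G (fun e => conorm Q (v e)) (fun e => conorm_gt0 (v_in e)) connG.

Lemma realization : exists phi : {additive 'cV[int]_g -> {ffun edge realized_graph -> int}},
  realizes Q phi /\ forall f, coparity (coedge phi f) = v f.
Proof.
have [co Hco] := choice comb_onto.
pose phi0 (x : 'cV[int]_g) : {ffun edge realized_graph -> int} := chain (co x).
have chain_ext c c' : c =1 c' -> chain c = chain c'.
  by move=> E; rewrite /chain; apply: eq_bigr => i _; rewrite E.
have phiB : zmod_morphism phi0.
  move=> x y; rewrite /phi0 -chainB; apply/chain_ext/comb_inj.
  by rewrite combB -!Hco.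
pose phi : {additive 'cV[int]_g -> {ffun edge realized_graph -> int}} :=
  HB.pack phi0 (GRing.isZmodMorphism.Build _ _ phi0 phiB).
have phiE x : phi x = chain (co x) by [].
exists phi; split; last first.
  move=> f; apply: covector_ext => alpha; have [x <-] := parity_surj alpha.
  by rewrite pairing_coedge phiE chain_parity -Hco.
split.
- have card := card_tree; rewrite card_chord in card.
  change (#|edge G|%:Z - #|vert G|%:Z + 1 = g%:Z).
  by move: #|edge G| #|vert G| card => m n; lia.
- split=> [x y E|z].
    rewrite (Hco x) (Hco y) /comb; apply: eq_bigr => i _.
    have /ffunP/(_ (val i)) := E; rewrite !phiE !chain_chord => /(congr1 ( *%R (o (val i)))).
    by rewrite !mulrA o_sqr !mul1r => ->.
  split=> [z0|[x <-]]; last exact: boundary_chain.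
  pose c i := o (val i) * z (val i); exists (comb c).
  rewrite phiE [RHS](cycle_chain z0); apply/chain_ext/comb_inj.
  by rewrite -Hco.
move=> x; rewrite {1}(Hco x) quadZ_comb /period_form.
by apply: eq_bigr.
Qed.

End Core.

Section CographicRealization.
Variables (R : realType) (g : nat) (Q : 'M[R]_g).
Hypothesis posQ : posdef_form Q.
Hypothesis ge0Q : conorms_ge0 Q.

(** The absolute values of the inner products come from [shortest_pair]: a class
    supported on two fundamental cycles involves no other chord.  The nesting of
    the cycles provides the common edges that [shortest_triple] needs, and so the
    hypothesis of [sign_choice]. *)
Lemma fundamental_gram (G : graph) (v : edge G -> 'rV['F_2]_g)
    (chord : {set edge G}) (D : edge G -> {set edge G}) (lev : edge G -> nat)
    (al : {f : edge G | f \in chord} -> 'cV['F_2]_g) :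
  injective v -> v @: [set: edge G] = csupp Q ->
  (forall a b, (forall i : {f : edge G | f \in chord},
      pairing (v (val i)) a = pairing (v (val i)) b) -> a = b) ->
  (forall i j, pairing (v (val j)) (al i) = (j == i)%:R) ->
  (forall i, Dset Q (al i) = v @: D (val i)) ->
  (forall f f1 f2, f \in chord -> f1 \in chord -> f2 \in chord -> f1 != f -> f2 != f ->
     (lev f1 <= lev f)%N -> (lev f2 <= lev f)%N ->
     D f1 :&: D f != set0 -> D f2 :&: D f != set0 -> D f1 :&: D f2 :&: D f != set0) ->
  exists r : {f : edge G | f \in chord} -> 'cV[int]_g,
    (forall i, parity (r i) = al i) /\
    forall i j, bilZ Q (r i) (r j) =
      \sum_e conorm Q (v e) * ((e \in D (val i))%:R * (e \in D (val j))%:R).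
Proof.
move=> v_inj v_csupp coord al_dual Dal nested.
have [r0 Hr0] : exists r0 : {f : edge G | f \in chord} -> 'cV[int]_g,
    forall i, parity (r0 i) = al i /\ shortest Q (r0 i).
  have ex i : exists x, parity x = al i /\ shortest Q x.
    by have [x Px Sx] := shortest_exists posQ (al i); exists x.
  by have [r0 H] := choice ex; exists r0.
have Pr0 i : parity (r0 i) = al i by have [] := Hr0 i.
have Sr0 i : shortest Q (r0 i) by have [] := Hr0 i.
have gram0 i j : i != j -> `|bilZ Q (r0 i) (r0 j)| = mass Q (Dset Q (al i) :&: Dset Q (al j)).
  move=> ij; rewrite -!Pr0; apply: shortest_pair => // beta; rewrite !Pr0 => sub.
  have zero k : k != i -> k != j -> pairing (v (val k)) beta = 0.
    move=> ki kj; apply/eqP; rewrite -[_ == 0]negbK F2_neq0; apply/negP => pk.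
    have : v (val k) \in Dset Q (al i) :|: Dset Q (al j).
      by apply: (subsetP sub); rewrite in_Dset pk andbT -v_csupp imset_f.
    by rewrite in_setU !in_Dset !al_dual (negPf ki) (negPf kj) !andbF.
  have same b : pairing (v (val i)) beta = pairing (v (val i)) b ->
      pairing (v (val j)) beta = pairing (v (val j)) b ->
      (forall k, k != i -> k != j -> pairing (v (val k)) b = 0) -> beta = b.
    move=> bi bj bk; apply: coord => k.
    have [->//|ki] := eqVneq k i; have [->//|kj] := eqVneq k j.
    by rewrite zero // bk.
  have ji : (j == i) = false by rewrite eq_sym (negPf ij).
  have off k : k != i -> k != j -> pairing (v (val k)) (al i) = 0 /\ pairing (v (val k)) (al j) = 0.
    by move=> /negPf ki /negPf kj; rewrite !al_dual ki kj.
  have [bi|bi] := F2_case (pairing (v (val i)) beta);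
  have [bj|bj] := F2_case (pairing (v (val j)) beta).
  - by constructor 1; apply: same => *; rewrite ?pairing0r.
  - constructor 3; apply: same; rewrite ?al_dual ?(negPf ij) ?eqxx //.
    by move=> k ki kj; have [] := off k ki kj.
  - constructor 2; apply: same; rewrite ?al_dual ?ji ?eqxx //.
    by move=> k ki kj; have [] := off k ki kj.
  constructor 4; apply: same; rewrite ?pairingDr ?al_dual ?(negPf ij) ?ji ?eqxx ?addr0 ?add0r //.
  by move=> k ki kj; have [E1 E2] := off k ki kj; rewrite pairingDr E1 E2 addr0.
have DI i j : Dset Q (al i) :&: Dset Q (al j) = v @: (D (val i) :&: D (val j)).
  by rewrite !Dal imsetI //; apply: in2W.
have massI i j : mass Q (Dset Q (al i) :&: Dset Q (al j)) =
    \sum_e conorm Q (v e) * ((e \in D (val i))%:R * (e \in D (val j))%:R).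
  rewrite DI /mass big_imset /=; last by move=> ? ? _ _; apply: v_inj.
  rewrite big_mkcond; apply: eq_bigr => e _; rewrite in_setI.
  by case: (e \in _); case: (e \in _); rewrite /= ?mulr1 ?mulr0 ?mul0r.
have meet i j : i != j -> bilZ Q (r0 i) (r0 j) != 0 -> D (val i) :&: D (val j) != set0.
  move=> ij; apply: contra_neq => E; apply/eqP; rewrite -normr_eq0 gram0 // DI E imset0.
  by rewrite /mass big_set0.
have [i j|i j k ij ik jk li lj bik bjk|eps Heps] :=
    @sign_choice R {f : edge G | f \in chord} (fun i => lev (val i)) (fun i j => bilZ Q (r0 i) (r0 j)).
- exact: bilZC.
- have h := nested (val k) (val i) (val j) (valP k) (valP i) (valP j) ik jk li lj
    (meet i k ik bik) (meet j k jk bjk).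
  apply: (shortest_triple posQ ge0Q); rewrite ?Pr0 ?gram0 //.
  rewrite DI Dal -imsetI; last by apply: in2W.
  by rewrite imset_eq0.
exists (fun i => if eps i then - r0 i else r0 i); split=> [i|i j].
  by case: (eps i); rewrite ?parityN Pr0.
have sgn i' j' : bilZ Q (if eps i' then - r0 i' else r0 i') (if eps j' then - r0 j' else r0 j') =
    (-1) ^+ (eps i') * (-1) ^+ (eps j') * bilZ Q (r0 i') (r0 j').
  case: (eps i'); case: (eps j'); rewrite ?bilZNl ?bilZNr ?expr0 ?expr1 ?mulr1 ?mul1r ?mulN1r //.
  by rewrite !opprK ?mul1r.
rewrite sgn -massI.
have [<-|ij] := eqVneq i j.
  rewrite -signr_addb addbb expr0 mul1r setIid -massE // -(Pr0 i).
  exact: Sr0.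
rewrite -gram0 // -[LHS]ger0_norm ?Heps // !normrM !normr_sign !mul1r.
by [].
Qed.

Lemma cographic_realization : cographic (binary_matroid (csupp Q)) ->
  exists (Gamma : metric_graph R)
    (phi : {additive 'cV[int]_g -> {ffun edge Gamma -> int}}),
    [/\ realizes Q phi, injective (fun f => coparity (coedge phi f)) &
        forall f, coparity (coedge phi f) \in csupp Q].
Proof.
move=> /cographicP[G [h [[h' hK h'K] H]]].
pose v (f : edge (joined G)) : 'rV['F_2]_g := val (h' f).
have h'_inj : injective h' := can_inj h'K.
have v_inj : injective v by apply: inj_comp h'_inj; apply: val_inj.
have v_csupp : v @: [set: edge (joined G)] = csupp Q.
  apply/setP => e; apply/imsetP/idP => [[f _ ->]|ee]; first exact: (valP (h' f)).
  by exists (h (Sub e ee)); rewrite ?in_setT // /v hK.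
have v_cut (T : {set edge (joined G)}) :
    \sum_(f in T) v f = 0 <-> exists S : {set vert (joined G)}, T = cut S.
  rewrite joined_cuts.
  have -> : \sum_(f in T) v f = \sum_(e in h' @: T) val e.
    by rewrite big_imset //= => ? ? _ _; apply: h'_inj.
  rewrite H -imset_comp (eq_imset (g := id)) ?imset_id //.
have connG := joined_connected G.
have [chord [D [o [lev [[card_tree o_unit D_chord D_cycle] tree_cut chord_cut nested]]]]] :=
  directed_fundamental_cycles connG.
have [card_chord [al al_dual]] :=
  chord_basis posQ ge0Q v_csupp v_cut tree_cut chord_cut.
have [r [r_par r_gram]] := fundamental_gram v_inj v_csupp
  (chord_coordinates posQ ge0Q v_csupp v_cut tree_cut) al_dual
  (Dset_al v_csupp v_cut D_chord tree_cut al_dual) nested.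
have [phi [real Hphi]] := realization posQ ge0Q connG v_inj v_csupp v_cut o_unit D_chord
  tree_cut al_dual D_cycle r_par r_gram card_tree card_chord.
exists (realized_graph connG v_csupp), phi; split=> // [f f'|f].
  by rewrite !Hphi; apply: v_inj.
by rewrite Hphi -v_csupp imset_f.
Qed.

End CographicRealization.

(** * Reconstructed coedges *)

Lemma unit_value_primitive g (c : 'rV[int]_g) (x : 'cV[int]_g) : (c *m x) 0 0 = 1 -> primitive_covector c.
Proof.
move=> cx k b E; move: cx; rewrite E -scalemxAl mxE => /(congr1 absz).
rewrite abszM => /eqP; rewrite muln_eq1 => /andP[/eqP h _].
by rewrite -abszE h.
Qed.

(** The vector [a(x0) x - a(x) x0] is in the kernel of [a], hence of [c], so that
    [a = a(x0) c]; primitivity of [a] makes [a(x0)] a sign. *)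
Lemma primitive_kernel g (a c : 'rV[int]_g) (x0 : 'cV[int]_g) : primitive_covector a ->
  (c *m x0) 0 0 = 1 -> (forall x : 'cV[int]_g, a *m x = 0 -> (c *m x) 0 0 = 0) ->
  c = a \/ c = - a.
Proof.
move=> prim cx0 ker.
have E : a = (a *m x0) 0 0 *: c.
  apply/matrixP => i j; rewrite (ord1 i) [RHS]mxE.
  pose dj : 'cV[int]_g := delta_mx j 0.
  have ent (b : 'rV[int]_g) : (b *m dj) 0 0 = b 0 j.
    rewrite mxE (bigD1 j) //= mxE !eqxx mulr1 big1 ?addr0 // => k kj.
    by rewrite mxE (negPf kj) mulr0.
  have expand (b : 'rV[int]_g) : (b *m ((a *m x0) 0 0 *: dj - a 0 j *: x0)) 0 0 =
      (a *m x0) 0 0 * b 0 j - a 0 j * (b *m x0) 0 0.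
    rewrite mulmxBr -!scalemxAr.
    by rewrite [LHS]mxE [X in X + _]mxE [X in _ + X]mxE [X in _ - X]mxE ent.
  have : a *m ((a *m x0) 0 0 *: dj - a 0 j *: x0) = 0.
    by apply/matrixP => k l; rewrite (ord1 k) (ord1 l) expand [RHS]mxE mulrC subrr.
  by move=> /ker; rewrite expand cx0 mulr1 => /eqP; rewrite subr_eq0 => /eqP.
have := prim _ _ E; set k := (a *m x0) 0 0 in E *.
have [k0|k0] := lerP 0 k; rewrite ?(ger0_norm k0) ?(ltr0_norm k0) => K.
  by left; rewrite E K scale1r.
by right; rewrite E -[k]opprK K scaleN1r opprK.
Qed.

Section IntSpan.
Variables (M : zmodType) (s : seq M).
Local Notation span := (inIntSpan (in_tuple s)).

Lemma span0 : span 0.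
Proof. by exists 0; rewrite big1 // => i _; rewrite ffunE mulr0z. Qed.

Lemma spanB x y : span x -> span y -> span (x - y).
Proof.
move=> [a ->] [b ->]; exists (a - b); rewrite -sumrB; apply: eq_bigr => i _.
by rewrite !ffunE mulrzBr.
Qed.

Lemma span_mem x : x \in s -> span x.
Proof.
move=> xs; have lt : (index x s < size s)%N by rewrite index_mem.
exists [ffun i => (i == Ordinal lt)%:Z]; rewrite (bigD1 (Ordinal lt)) //=.
rewrite ffunE eqxx mulr1z nth_index // big1 ?addr0 // => i /negPf E.
by rewrite ffunE E mulr0z.
Qed.

Lemma span_ind (P : M -> Prop) : P 0 -> (forall x y, P x -> P y -> P (x + y)) ->
  (forall x, P x -> P (- x)) -> (forall x, x \in s -> P x) -> forall x, span x -> P x.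
Proof.
move=> P0 PD PN Ps _ [a ->]; apply: (big_ind P) => // i _.
have Pi : P s`_i by apply/Ps/mem_nth.
have Pn n : P (s`_i *+ n) by elim: n => [|n IH]; rewrite ?mulr0n // mulrS; apply: PD.
by case: (a i) => n; rewrite ?NegzE ?mulrNz -?pmulrn //; apply/PN/Pn.
Qed.

End IntSpan.

Section Reconstruction.
Variables (R : realType) (g : nat) (Q : 'M[R]_g).
Hypothesis posQ : posdef_form Q.
Variables (Gamma : metric_graph R)
  (phi : {additive 'cV[int]_g -> {ffun edge Gamma -> int}}).
Hypothesis real : realizes Q phi.
Implicit Types (f : edge Gamma) (x : 'cV[int]_g) (e : 'rV['F_2]_g) (alpha : 'cV['F_2]_g).

Local Notation cls f := (coparity (coedge phi f)).

(** A cocircuit [B] that avoids the class of [f] gives an even coordinate of [r B], and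
    the coordinates of shortest vectors are 0, 1 and -1. *)
Lemma Le_coedge r f x : (forall B, cocircuit Q B -> shortest_for Q B (r B)) ->
  ~~ bridge f -> in_Le Q r (cls f) x -> phi x f = 0.
Proof.
move=> Hr nb; apply: (span_ind (P := fun x => phi x f = 0)).
- by rewrite raddf0 ffunE.
- by move=> y z Ey Ez; rewrite raddfD ffunE Ey Ez.
- by move=> y Ey; rewrite raddfN ffunE Ey.
move=> u /mapP[B]; rewrite mem_enum inE => /andP[cB fB] ->.
have [DB short] := Hr B cB.
have := shortest_unit posQ real f short.
have clsE : cls f \in csupp Q by rewrite -(csupp_period posQ real) imset_f.
have : cls f \notin Dset Q (parity (r B)) by rewrite DB.
rewrite in_Dset clsE pairing_coedge odd_intr_F2 /=.
have even_small (n : int) : ~~ odd `|n| -> `|n| <= 1 -> n = 0 by lia.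
exact: even_small.
Qed.

Lemma reconstruction_aggregates r a : reconstruction Q r a -> aggregates_to Q a phi.
Proof.
move=> [Hr Ha]; split; first exact: csupp_period.
  exact: conorm_nonbridge.
move=> f nb; have clsE : cls f \in csupp Q by rewrite -(csupp_period posQ real) imset_f.
have [prim ker] := Ha _ clsE.
have [x0 Ex0] := nonbridge_unit real nb.
apply: (primitive_kernel (x0 := x0)) prim _ _; first by rewrite coedgeE.
by move=> x /ker Lx; rewrite coedgeE; apply: Le_coedge Lx.
Qed.

(** Peeling off cocircuits writes the support of a class avoiding [e] as a disjoint
    union of cocircuits; the vectors of these are pairwise orthogonal, so
    that their sum is a shortest vector of the class. *)
Lemma shortest_Le r e alpha : (forall B, cocircuit Q B -> shortest_for Q B (r B)) ->
  e \notin Dset Q alpha ->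
  exists y, [/\ in_Le Q r e y, parity y = alpha & shortest Q y].
Proof.
have ge0Q := period_conorms_ge0 posQ real.
move=> Hr; have [n] := ubnP #|Dset Q alpha|; elim: n alpha => // n IHn alpha lt_n eD.
have [->|a0] := eqVneq alpha 0.
  exists 0; split; [exact: span0|exact: parity0|exact: shortest0].
pose P B := [exists al : 'cV['F_2]_g, (al != 0) && (B == Dset Q al)].
have [|B minB sB] := @minset_exists _ P (Dset Q alpha).
  by apply/existsP; exists alpha; rewrite a0 eqxx.
have cB : cocircuit Q B by exact: minB.
have /minsetP[/existsP[al /andP[al0 /eqP EB]] _] := minB.
have [DB short] := Hr B cB.
have Pal : parity (r B) = al.
  apply: (vector_ext_csupp posQ ge0Q) => e' e'E.
  have /setP/(_ e') := etrans DB EB; rewrite !in_Dset e'E /=.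
  by have [->|->] := F2_case (pairing e' (parity (r B)));
     have [->|->] := F2_case (pairing e' al).
have Dsub : Dset Q (alpha + al) = Dset Q alpha :\: B.
  apply/setP => e'; rewrite in_setD EB !in_Dset pairingDr.
  have := subsetP sB e'; rewrite EB !in_Dset; case: (e' \in csupp Q) => //=.
  by have [->|->] := F2_case (pairing e' alpha); have [->|->] := F2_case (pairing e' al) => // /(_ isT).
have B0 : B != set0.
  by apply: contra_neq al0 => E; apply: (Dset_eq0 posQ ge0Q); rewrite -EB E.
have [||y [Ly Py Sy]] := IHn (alpha + al).
- rewrite -ltnS; apply: leq_trans lt_n; rewrite ltnS Dsub.
  apply: proper_card; rewrite properEneq subsetDl andbT.
  apply: contra_neq B0 => E; apply/eqP; rewrite -subset0; apply/subsetP => x xB.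
  by have := subsetP sB x xB; rewrite -E inE xB.
- by rewrite Dsub in_setD (negPf eD) andbF.
have eB : e \notin B by apply: contra eD; apply: (subsetP sB).
have LrB : in_Le Q r e (r B).
  by apply/span_mem/mapP; exists B; rewrite // mem_enum inE cB.
exists (r B + y); split.
- have -> : r B + y = r B - (0 - y) by rewrite sub0r opprK.
  by apply: spanB => //; apply: spanB => //; apply: span0.
- by rewrite parityD Pal Py addrC -addrA matrix_F2_addxx addr0.
have dis : Dset Q (parity (r B)) :&: Dset Q (parity y) = set0.
  rewrite Py Dsub DB; apply/setP => x; rewrite !inE; by case: (x \in B).
have orth : bilZ Q (r B) y = 0.
  have := bilZ_le_mass posQ ge0Q short Sy; rewrite dis /mass big_set0 normr_le0.
  by move=> /eqP.
rewrite /shortest quadZD // orth mulr0 addr0 parityD (vonormD posQ ge0Q) dis.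
by rewrite {1}/mass big_set0 mulr0 subr0 Sy short.
Qed.

(** The coedges of any realization serve as reconstructed coedges; that the kernel of
    such a coedge is spanned by the [r_D] is another instance of the descent. *)
Lemma reconstruction_exists : exists r a, reconstruction Q r a.
Proof.
have ge0Q := period_conorms_ge0 posQ real.
have ex_r B : exists x, cocircuit Q B -> shortest_for Q B x.
  case: (boolP (cocircuit Q B)) => [cB|_]; last by exists 0.
  have /minsetP[/existsP[al /andP[_ /eqP ->]] _] := cB.
  have [x Px Sx] := shortest_exists posQ al; exists x => _.
  by rewrite /shortest_for Px; split=> //; rewrite -Px.
have [r Hr] := choice ex_r.
have ex_f e : exists c : 'rV[int]_g, e \in csupp Q ->
    exists f, [/\ ~~ bridge f, cls f = e & c = coedge phi f].
  case: (boolP (e \in csupp Q)) => [|_]; last by exists 0.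
  rewrite -{1}(csupp_period posQ real) => /imsetP[f nb ->].
  by exists (coedge phi f) => _; exists f; split.
have [a Ha] := choice ex_f.
exists r, a; split; first exact: Hr.
move=> e eE; have [f [nb Ef ->]] := Ha e eE.
split; first by have [x xf] := nonbridge_unit real nb; apply: (@unit_value_primitive _ _ x); rewrite coedgeE.
have zeroE x : coedge phi f *m x = 0 <-> phi x f = 0.
  rewrite -coedgeE; split=> [->|E]; first by rewrite mxE.
  by apply/matrixP => i j; rewrite (ord1 i) (ord1 j) E mxE.
move=> x; rewrite zeroE; split; last by rewrite -Ef; apply: Le_coedge.
apply: (halving_descent posQ (K := in_Le Q r e) (K' := fun x => phi x f = 0)).
- exact: span0.
- exact: spanB.
- move=> u y z Eu Ly Ez; have Ey : phi y f = 0 by apply: (Le_coedge Hr nb); rewrite Ef.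
  have double (n : int) : 0 - 0 = n + n -> n = 0 by lia.
  by have := congr1 (fun u => phi u f) Ez; rewrite raddfB raddfD /= !ffunE Eu Ey => /double.
move=> u Eu; have [|y [Ly Py Sy]] := shortest_Le (e := e) (alpha := parity u) Hr.
  by rewrite in_Dset -Ef pairing_coedge Eu andbF.
by exists y; split=> //; rewrite [leLHS]Sy Py vonorm_le.
Qed.

End Reconstruction.

Section Certificate.
Variables (R : realType) (g : nat) (Q : 'M[R]_g).
Hypothesis posQ : posdef_form Q.

Lemma symmetric_ext (M N : 'M[R]_g) : M^T = M -> N^T = N ->
  (forall x : 'cV[int]_g, quadZ M x = quadZ N x) -> M = N.
Proof.
move=> symM symN H.
have ent (P : 'M[R]_g) i j : bilZ P (delta_mx i 0) (delta_mx j 0) = P i j.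
  rewrite /bilZ !map_delta_mx trmx_delta -rowE -colE /scalar_of !mxE.
  by [].
have pol (P : 'M[R]_g) (x y : 'cV[int]_g) : P^T = P ->
    2 * bilZ P x y = quadZ P (x + y) - quadZ P x - quadZ P y.
  move=> symP; have C : bilZ P y x = bilZ P x y.
    rewrite /bilZ /scalar_of.
    have := congr1 (fun M : 'M_1 => M 0 0) (trmx_mul ((map_mx intr x)^T *m P) (map_mx intr y)).
    by rewrite mxE => ->; rewrite trmx_mul trmxK symP mulmxA.
  by rewrite !quadZ_bil bilZDl !bilZDr C; ring.
apply/matrixP => i j; rewrite -!ent.
have two : (2 : R) != 0 by rewrite pnatr_eq0.
by apply: (mulfI two); rewrite !pol // !H.
Qed.

Variable a : 'rV['F_2]_g -> 'rV[int]_g.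

Lemma certificate_matrix : graph_period_certificate Q a ->
  Q = map_mx intr (coedge_mx Q a) *m diag_mx (conorm_row Q) *m (map_mx intr (coedge_mx Q a))^T.
Proof.
move=> [Gamma [phi [sigma [real sinj simg slen sco]]]].
set A := map_mx intr _; apply: symmetric_ext; first exact: posQ.1.
  by rewrite !trmx_mul trmxK tr_diag_mx mulmxA.
move=> x; have [_ _ ->] := real.
pose val_a e := (a e *m x) 0 0.
have -> : quadZ (A *m diag_mx (conorm_row Q) *m A^T) x =
    \sum_(e in csupp Q) conorm Q e * (val_a e)%:~R ^+ 2.
  rewrite /quadZ /quad /scalar_of.
  have -> : (map_mx intr x)^T *m (A *m diag_mx (conorm_row Q) *m A^T) *m map_mx intr x =
     ((map_mx intr x)^T *m A) *m diag_mx (conorm_row Q) *m ((map_mx intr x)^T *m A)^T.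
    by rewrite trmx_mul trmxK !mulmxA.
  have entry j : ((map_mx intr x)^T *m A) 0 j = (val_a (enum_val j))%:~R.
    rewrite /val_a !mxE rmorph_sum /=; apply: eq_bigr => i _.
    by rewrite !mxE rmorphM /= mulrC.
  rewrite mul_mx_diag mxE [RHS]big_enum_val /=; apply: eq_bigr => j _.
  by rewrite [X in X * _]mxE [X in _ * X]mxE entry mxE; ring.
rewrite -simg big_imset /=; last by move=> ? ? _ _; apply: sinj.
rewrite /period_form; apply: eq_big => f; first by rewrite in_setT.
move=> _; rewrite slen -coedgeE /val_a.
by have [->|->] := sco f; rewrite // mulNmx mxE mulrNz sqrrN.
Qed.

Lemma injective_certificate (Gamma : metric_graph R)
    (phi : {additive 'cV[int]_g -> {ffun edge Gamma -> int}}) :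
  realizes Q phi -> injective (fun f => coparity (coedge phi f)) ->
  (forall f, coparity (coedge phi f) \in csupp Q) ->
  aggregates_to Q a phi -> graph_period_certificate Q a.
Proof.
move=> real inj supp [agg1 agg2 agg3].
have nb (f : edge Gamma) : ~~ bridge f.
  by rewrite -(cls_eq0 real); have := supp f; rewrite inE => /andP[].
exists Gamma, phi, (fun f => coparity (coedge phi f)); split=> //.
- rewrite -agg1.
  by apply/setP => e; apply/imsetP/imsetP => -[f _ ->]; exists f => //; apply: nb.
- move=> f; rewrite agg2 // (big_pred1 f) // => f'.
  by rewrite nb /= (inj_eq inj).
by move=> f; apply: agg3.
Qed.

End Certificate.

Theorem corollary7p3 (R : realType) (g : nat) (Q : 'M[R]_g)
    (posQ : posdef_form Q) :
  ((exists Gamma : metric_graph R, tropical_Riemann_matrix Q Gamma) <->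
   conorms_ge0 Q /\ cographic (binary_matroid (csupp Q))) /\
  (conorms_ge0 Q -> cographic (binary_matroid (csupp Q)) ->
   (exists (r : {set 'rV['F_2]_g} -> 'cV[int]_g) (a : 'rV['F_2]_g -> 'rV[int]_g),
      reconstruction Q r a) /\
   forall (r : {set 'rV['F_2]_g} -> 'cV[int]_g) (a : 'rV['F_2]_g -> 'rV[int]_g),
     reconstruction Q r a ->
     [/\ forall (Gamma : metric_graph R)
           (phi : {additive 'cV[int]_g -> {ffun edge Gamma -> int}}),
           realizes Q phi -> aggregates_to Q a phi,
         Q = map_mx intr (coedge_mx Q a) *m diag_mx (conorm_row Q)
               *m (map_mx intr (coedge_mx Q a))^T &
         graph_period_certificate Q a]).
Proof.
split; first split.
- move=> [Gamma [phi real]]; split; first exact: period_conorms_ge0 real.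
  exact: csupp_cographic real.
- move=> [ge0Q cog]; have [Gamma [phi [real _ _]]] := cographic_realization posQ ge0Q cog.
  by exists Gamma, phi.
move=> ge0Q cog; have [Gamma [phi [real inj supp]]] := cographic_realization posQ ge0Q cog.
split; first exact: reconstruction_exists real.
move=> r a rec.
have agg (Gamma' : metric_graph R)
    (phi' : {additive 'cV[int]_g -> {ffun edge Gamma' -> int}}) :
    realizes Q phi' -> aggregates_to Q a phi'.
  by move=> real'; apply: reconstruction_aggregates rec.
have cert := injective_certificate real inj supp (agg _ _ real).
by split=> //; apply: certificate_matrix.
Qed.
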